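(* For integer partitions $\lambda\vdash n$, the functions $S_\lambda\in\Pi(\mathbf x)$ satisfy: (i) $S_\lambda=\sum_{\mu\unlhd\lambda}\mu!\,K_{\lambda,\mu}\sum_{\lambda(\sigma)=\mu}m_\sigma$ (inner sum over set partitions $\sigma$ of $[n]$ of type $\mu$); (ii) the $S_\lambda$ (over all partitions $\lambda$) are linearly independent; (iii) $\rho(S_\lambda)=n!\,s_\lambda$; (iv) $\tilde\rho(n!\,s_\lambda)=S_\lambda$; (v) $\langle S_\lambda,S_\mu\rangle=n!^2\delta_{\lambda,\mu}$ for $\lambda,\mu\vdash n$.
   Context: $\Pi(\mathbf{x})$ is the algebra of bounded-degree elements of $\mathbb{Q}\langle\langle x_1,x_2,\ldots\rangle\rangle$ (noncommuting variables) invariant under all permutations of the variables; $\rho$ lets the variables commute; $s_\lambda$ is the ordinary Schur function, $K_{\lambda,\mu}$ Kostka numbers, $\unlhd$ dominance order, $\mu!=\prod\mu_j!$. For $\lambda\vdash n$, define $S_\lambda$ as follows: consider fillings of the Young diagram of $\lambda$ in which each cell gets a positive integer and also a label from $[n]$, each label used exactly once, such that the integers weakly increase along rows and strictly increase down columns; such a filling contributes the monomial $x_{i_1}x_{i_2}\cdots x_{i_n}$ where $i_k$ is the integer in the cell labeled $k$; $S_\lambda$ is the sum of these monomials over all such fillings. For a set partition $\sigma$ of $[n]$, $m_\sigma=\sum x_{i_1}\cdots x_{i_n}$ over $n$-tuples with $i_j=i_k$ iff $j,k$ are in the same block; $\lambda(\sigma)$ is its type (block-size partition). The lifting map is the linear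 map $\tilde\rho:\Lambda(\mathbf x)\to\Pi(\mathbf x)$, $\tilde\rho(m_\lambda)=\frac{\lambda!}{n!}\sum_{\lambda(\pi)=\lambda}m_\pi$. The bilinear form on $\Pi(\mathbf x)$ is defined by $\langle m_\pi,h_\sigma\rangle=n!\delta_{\pi,\sigma}$ for $\pi\vdash[n]$, where $h_\sigma=\sum_{(f,L)}f(1)\cdots f(n)$ over functions $f:[n]\to\{x_1,x_2,\dots\}$ together with a linear ordering $L$ of each block of $(\ker f)\wedge\sigma$, $\ker f$ being the set partition into nonempty fibers of $f$ and $\wedge$ the meet in the refinement order. *)

(* Defs.v *)
From HB Require Import structures.
From mathcomp Require Import all_boot all_order all_algebra.
From mathcomp Require Import finmap multiset.
From mathcomp Require Import boolp classical_sets functions cardinality fsbigop.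

Set Implicit Arguments.
Unset Strict Implicit.
Unset Printing Implicit Defensive.

Import GRing.Theory.

Local Open Scope mset_scope.
Local Open Scope classical_set_scope.
Local Open Scope ring_scope.

(* The variables x_1, x_2, ... are indexed by nat, the index i standing for
   x_(i+1). A series is identified with its coefficient function: on words for
   noncommuting variables, on multisets of indices for commuting ones. Sums and
   scalar multiples of series are the pointwise ones; rat^o is rat as a module
   over itself. *)
Definition ncseries := seq nat -> rat^o.
Definition cseries := {mset nat} -> rat^o.

(* The formal sum of the monomials [mon i] for i in A. The sums below all have
   finite fibers, so the coefficient of x is the number of i in A with
   mon i = x. *)
Definition monomial_sum (I X : choiceType) (A : set I) (mon : I -> X) : X -> rat :=
  fun x => \sum_(i \in [set i | A i /\ mon i = x]) (1 : rat).

Definition Pi_alg : set ncseries := [set f |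
  (exists d : nat, forall w : seq nat, (d < size w)%N -> f w = 0) /\
  (forall p : nat -> nat, bijective p -> forall w, f [seq p i | i <- w] = f w)].

Definition Lambda_alg : set cseries := [set f |
  (exists d : nat, forall e : {mset nat}, (d < size e)%N -> f e = 0) /\
  (forall p : nat -> nat, bijective p ->
     forall e : {mset nat}, f (seq_mset [seq p i | i <- e]) = f e)].

(* [rho] lets the variables commute: the coefficient of a commutative monomial
   is the sum of the coefficients of its finitely many rearrangements. *)
Definition rho (f : ncseries) : cseries :=
  fun e => \sum_(w \in [set w : seq nat | seq_mset w = e]) f w.

Definition is_partn (n : nat) (la : seq nat) : bool :=
  [&& sorted geq la, 0%N \notin la & sumn la == n].

Definition dominated (mu la : seq nat) : Prop :=
  forall k : nat, (sumn (take k mu) <= sumn (take k la))%N.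

(* mu! *)
Definition partn_fact (mu : seq nat) : nat := (\prod_(j <- mu) j`!)%N.

(* A cell is a pair of a row index [tag c] and a column index [tagged c]. *)
Definition cell (la : seq nat) := {i : 'I_(size la) & 'I_(nth 0%N la i)}.

Definition semistandard (la : seq nat) (T : cell la -> nat) : bool :=
  [forall c : cell la, forall d : cell la,
     (((tag c == tag d :> nat) && (tagged c < tagged d)%N) ==> (T c <= T d)%N) &&
     (((tagged c == tagged d :> nat) && (tag c < tag d)%N) ==> (T c < T d)%N)].

Definition schur (la : seq nat) : cseries :=
  monomial_sum [set T : {ffun cell la -> nat} | semistandard T]
    (fun T => seq_mset [seq T c | c <- enum {: cell la}]).

(* Since the number [i+1] occurs [nth 0 mu i] times, no entry exceeds
   [size mu]. *)
Definition Kostka (la mu : seq nat) : nat :=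
  #|[set T : {ffun cell la -> 'I_(size mu)} |
      semistandard (fun c => T c) &&
      [forall i : 'I_(size mu), #|[set c | T c == i]%SET| == nth 0%N mu i]]%SET|.

(* [F.2 k] is the cell labeled k. *)
Definition Schur_nc (la : seq nat) : ncseries :=
  monomial_sum
    [set F : {ffun cell la -> nat} * {ffun 'I_(sumn la) -> cell la} |
       semistandard F.1 /\ bijective F.2]
    (fun F => [seq F.1 (F.2 k) | k <- enum 'I_(sumn la)]).

Definition set_partition (n : nat) (P : {set {set 'I_n}}) : bool :=
  finset.partition P [set: 'I_n]%SET.

Definition block_type (n : nat) (P : {set {set 'I_n}}) : seq nat :=
  sort geq [seq #|(B : {set 'I_n})| | B <- enum P].

Definition m_nc (n : nat) (P : {set {set 'I_n}}) : ncseries :=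
  monomial_sum
    [set t : n.-tuple nat |
       forall j k : 'I_n, tnth t j = tnth t k <-> k \in finset.pblock P j]
    (fun t => t : seq nat).

(* The multiset of the nonzero exponents of the monomial is la. *)
Definition m_comm (la : seq nat) : cseries :=
  monomial_sum
    [set e : {mset nat} | sort geq [seq e i | i <- undup e] = la]
    id.

Definition partition_meet (n : nat) (P Q : {set {set 'I_n}}) : {set {set 'I_n}} :=
  ([set B :&: C | B in P, C in Q] :\ finset.set0)%SET.

Definition kernel (n : nat) (f : {ffun 'I_n -> nat}) : {set {set 'I_n}} :=
  finset.preim_partition f [set: 'I_n]%SET.

(* A family of linear orders, one on each block of P, encoded as the set of all
   pairs (i, j) with i <= j in the order of their common block. *)
Definition block_orders (n : nat) (P : {set {set 'I_n}}) (L : {set 'I_n * 'I_n}) : Prop :=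
  let le_L : rel 'I_n := fun i j => (i, j) \in L in
  (forall i j, le_L i j -> j \in finset.pblock P i) /\
  (forall B : {set 'I_n}, B \in P ->
     [/\ {in B &, antisymmetric le_L}, {in B & &, transitive le_L}
       & {in B &, total le_L}]).

Definition h_nc (n : nat) (P : {set {set 'I_n}}) : ncseries :=
  monomial_sum
    [set F : {ffun 'I_n -> nat} * {set 'I_n * 'I_n} |
       block_orders (partition_meet (kernel F.1) P) F.2]
    (fun F => [seq F.1 i | i <- enum 'I_n]).

(* R restricts to the lifting map from Lambda to Pi; its values outside Lambda
   are irrelevant. *)
Definition is_lifting_map (R : cseries -> ncseries) : Prop :=
  [/\ forall f, Lambda_alg f -> Pi_alg (R f),
      forall (a : rat) f g, Lambda_alg f -> Lambda_alg g ->
        R (a *: f + g) = a *: R f + R g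
    & forall n la, is_partn n la ->
        R (m_comm la) = ((partn_fact la)%:R / n`!%:R) *:
          \sum_(P : {set {set 'I_n}} |
                 set_partition P && (block_type P == la)) m_nc P].

(* B restricts to the bilinear form on Pi; its values outside Pi are
   irrelevant. The m_P form a basis of Pi, and so do the h_Q, hence these
   conditions determine the form on Pi. *)
Definition is_Pi_form (B : ncseries -> ncseries -> rat) : Prop :=
  [/\ forall (a : rat) f g h, Pi_alg f -> Pi_alg g -> Pi_alg h ->
        B (a *: f + g) h = a * B f h + B g h,
      forall (a : rat) f g h, Pi_alg f -> Pi_alg g -> Pi_alg h ->
        B h (a *: f + g) = a * B h f + B h g,
      forall n (P Q : {set {set 'I_n}}),
        set_partition P -> set_partition Q ->
        B (m_nc P) (h_nc Q) = n`!%:R * (P == Q)%:R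
    & forall n k (P : {set {set 'I_n}}) (Q : {set {set 'I_k}}), n <> k ->
        set_partition P -> set_partition Q ->
        B (m_nc P) (h_nc Q) = 0].

(* Main.v *)
(** The coefficient of a word w of content type mu in S_lambda is
    mu! K_(lambda,mu): a tableau T of that content is labelled so as to give w
    in as many ways as there are permutations preserving w, namely mu!. Since
    the coefficient of w in m_sigma is 1 or 0 according to whether sigma is the
    kernel of w, this gives (i), (iii) and (iv); (ii) follows because Kostka
    numbers are triangular for dominance.

    The remaining inputs are the symmetry of K_(lambda,alpha) in alpha and the
    orthogonality (v). Both come from the Cauchy identity
      sum_lambda K_(lambda,alpha) K_(lambda,beta) =
        number of nat-valued matrices with margins alpha, beta,
    proved by commuting "add a horizontal strip" past "remove a horizontal
    strip" with the piecewise-linear local rule of RSK. Symmetry: the right-hand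
    side is invariant under permuting alpha and beta separately, so
    sum_lambda (K_(lambda,alpha) - K_(lambda,alpha'))^2 = 0 when alpha' rearranges
    alpha. Orthogonality: summing h_(ker g) over the maps g of content nu gives
    sum_mu K_(mu,nu) S_mu, because the pairs (g, family of orders) are counted by
    the orbits of the stabilizer of w on the maps g, which are matrices; pairing
    with S_lambda gives sum_mu K_(mu,nu) <S_lambda,S_mu> = n!^2 K_(lambda,nu),
    and (ii) inverts this system. *)

Require Import Defs.
From mathcomp Require Import all_boot all_order all_algebra all_fingroup.
From mathcomp Require Import zify.
From mathcomp Require Import finmap multiset.
From mathcomp Require Import boolp classical_sets functions cardinality fsbigop.

Set Implicit Arguments.
Unset Strict Implicit.
Unset Printing Implicit Defensive.

Import GRing.Theory.

(** * Permutations preserving a map *)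

(** [Kostka] takes its content sorted, whereas the letters of a word occur with counts in arbitrary
    order and with gaps. This is why even the coefficient formula depends on the symmetry in alpha.
    Since (v) calls for the Cauchy identity anyway, the symmetry is drawn from it and not from an
    involution on tableaux. All multiplicities come from permutations acting on maps out of ['I_n].
    Labellings of a tableau, rearrangements of a word and families of orders correspond to cosets,
    orbits and stabilizers, and [card_stab] evaluates the stabilizers as products of factorials. The
    index types of the series are infinite, but a given word meets only finitely many indices, so
    the counting takes place in finite types. Shapes live in [{ffun 'I_n.+1 -> 'I_n.+1}]; weight at
    most n leaves the last row empty, which keeps the local rule exact at the boundary. *)

Definition fiber_card (T : finType) (X : eqType) (f : T -> X) (x : X) : nat :=
  #|[set i | f i == x]|.

Lemma fiber_cardE (T : finType) (X : eqType) (f : T -> X) (x : X) :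
  fiber_card f x = count_mem x [seq f i | i <- enum T].
Proof.
rewrite count_map enumT /fiber_card cardsE cardE /enum_mem size_filter.
exact: eq_count.
Qed.

Definition stab (T : finType) (X : eqType) (f : T -> X) : {set {perm T}} :=
  [set s : {perm T} | [forall i, f (s i) == f i]].

Lemma stabP (T : finType) (X : eqType) (f : T -> X) (s : {perm T}) :
  reflect (forall i, f (s i) = f i) (s \in stab f).
Proof. by rewrite inE; apply: (iffP forallP) => H i; apply/eqP/H. Qed.

(** Bounding the support by [D] makes it possible to count [stab f] by induction, one fiber at a
    time. *)
Definition stab_on (T : finType) (X : eqType) (f : T -> X) (D : {set T}) : {set {perm T}} :=
  [set s in stab f | perm_on D s].

Lemma stab_onP (T : finType) (X : eqType) (f : T -> X) (D : {set T}) (s : {perm T}) :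
  reflect ((forall i, f (s i) = f i) /\ perm_on D s) (s \in stab_on f D).
Proof. by apply: (iffP setIdP) => -[/stabP]. Qed.

Lemma stab_on_group_set (T : finType) (X : eqType) (f : T -> X) (D : {set T}) :
  group_set (stab_on f D).
Proof.
apply/group_setP; split => [|s t].
  by apply/stab_onP; rewrite perm_on1; split => // i; rewrite perm1.
move=> /stab_onP[fs Ds] /stab_onP[ft Dt]; apply/stab_onP.
by rewrite perm_onM //; split => // i; rewrite permM ft fs.
Qed.
Canonical stab_on_group (T : finType) (X : eqType) (f : T -> X) (D : {set T}) :=
  Group (stab_on_group_set f D).

Lemma perm_on_group_set (T : finType) (D : {set T}) :
  group_set [set s : {perm T} | perm_on D s].
Proof.
apply/group_setP; split => [|s t]; rewrite !inE ?perm_on1 //.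
exact: perm_onM.
Qed.
Canonical perm_on_group (T : finType) (D : {set T}) := Group (perm_on_group_set D).

(** The group for [x :: xs] is the product of the symmetric group of the fiber over [x] and the
    group for [xs]. These have disjoint supports, hence meet trivially, and the orders multiply. *)
Lemma card_stab_on (T : finType) (X : eqType) (f : T -> X) (xs : seq X) :
  uniq xs ->
  #|stab_on f [set i | f i \in xs]| =
    \prod_(x <- xs) (fiber_card f x)`!.
Proof.
elim: xs => [_|x xs IH /= /andP[xxs uxs]].
  rewrite big_nil -[RHS](cards1 (1%g : {perm T})); apply: eq_card => s.
  rewrite finset.in_set1; apply/stab_onP/eqP => [[_ /fintype.subsetP D]|->].
    apply/permP => i; rewrite perm1; apply/eqP; apply: contraT => si.
    by have := D i; rewrite !inE => /(_ si).
  by rewrite perm_on1; split => // i; rewrite perm1.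
rewrite big_cons -IH // /fiber_card.
set F := [set i | f i == x]; set D := [set i | f i \in xs].
rewrite -card_perm -[#|perm_on F|]cardsE.
transitivity #|(perm_on_group F * stab_on_group f D)%g|; last first.
  apply: TI_cardMg.
  apply/trivgP/fintype.subsetP => s; rewrite inE => /andP[].
  rewrite inE => /fintype.subsetP Fs /stab_onP[_ /fintype.subsetP Ds].
  apply/finset.set1P/permP => i; rewrite perm1; apply/eqP; apply: contraT => si.
  have := Fs _ si; have := Ds _ si; rewrite !inE => + /eqP fi.
  by rewrite fi (negPf xxs).
rewrite /=; apply: eq_card => s; apply/idP/mulsgP => [|[s1 s2]].
  move=> /stab_onP[fs /fintype.subsetP sD].
  (* [restr_perm] is the restriction of [s] only if [s] maps [F] to itself; it does because [s]
     preserves [f]. *)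
  have sN : s \in ('N(F | 'P))%g.
    by apply/astabsP => i; rewrite !inE /= apermE fs.
  have rE i : i \in F -> restr_perm F s i = s i by move=> iF; rewrite restr_permE.
  have rO i : i \notin F -> restr_perm F s i = i.
    by move=> iF; apply: (out_perm (restr_perm_on F s)).
  have fr i : f (restr_perm F s i) = f i.
    by case: (boolP (i \in F)) => iF; [rewrite rE // fs | rewrite rO].
  exists (restr_perm F s) ((restr_perm F s)^-1 * s)%g.
  - by rewrite inE restr_perm_on.
  - have frV i : f ((restr_perm F s)^-1%g i) = f i.
      by rewrite -[in RHS](permKV (restr_perm F s) i) fr.
    apply/stab_onP; split; first by move=> i; rewrite permM fs frV.
    apply/fintype.subsetP => i; rewrite !inE permM => si.
    case: (boolP (i \in F)) => iF.
      case/negP: si; rewrite -rE ?permKV // inE frV; by rewrite inE in iF.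
    have rVi : (restr_perm F s)^-1%g i = i by apply: (@perm_inj _ (restr_perm F s)); rewrite permKV rO.
    move: si; rewrite rVi => /sD; rewrite !inE; rewrite inE in iF.
    by rewrite (negPf iF).
  - by rewrite mulKVg.
rewrite inE => /fintype.subsetP F1 /stab_onP[f2 /fintype.subsetP D2] ->.
have f1 i : f (s1 i) = f i.
  case: (eqVneq (s1 i) i) => [-> //|si]; have := F1 _ si.
  have : s1 i \in F by apply: F1; rewrite inE (inj_eq perm_inj).
  by rewrite !inE => /eqP -> /eqP ->.
apply/stab_onP; split; first by move=> i; rewrite permM f2 f1.
apply/fintype.subsetP => i; rewrite !inE permM => si.
case: (eqVneq (s1 i) i) => [s1i|/F1]; last by rewrite inE => ->.
by move: si; rewrite s1i => /D2; rewrite inE => ->; rewrite orbT.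
Qed.

Lemma card_stab (T : finType) (X : eqType) (f : T -> X) (xs : seq X) :
  uniq xs -> (forall i, f i \in xs) ->
  #|stab f| = \prod_(x <- xs) (fiber_card f x)`!.
Proof.
move=> uxs fxs; rewrite -card_stab_on //; apply: eq_card => s.
apply/stabP/stab_onP => [fs|[]//]; split=> //; apply/fintype.subsetP => i; by rewrite inE fxs.
Qed.

(** The value tuples of [f] and [g] are rearrangements of each other. In terms of actions:
    permutations are transitive on the maps with given fiber sizes. *)
Lemma perm_of_fibers (n : nat) (X : eqType) (f g : 'I_n -> X) :
  (forall x, fiber_card f x = fiber_card g x) ->
  exists s : 'S_n, forall i, g i = f (s i).
Proof.
move=> fg.
have cnt (h : 'I_n -> X) x : count_mem x [tuple h i | i < n] = fiber_card h x.
  by rewrite fiber_cardE.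
have /tuple_permP[s sE] : perm_eq [tuple g i | i < n] [tuple f i | i < n].
  by apply/allP => x _ /=; rewrite !cnt fg.
exists s => i; have := congr1 (fun t : n.-tuple X => tnth t i) (val_inj sE).
by rewrite !tnth_mktuple.
Qed.

Lemma exists_fibers (X : finType) (a : X -> nat) (n : nat) :
  \sum_x a x = n -> exists f : 'I_n -> X, forall x, fiber_card f x = a x.
Proof.
move=> an; pose s := flatten [seq nseq (a x) x | x <- enum X].
have szs : size s == n.
  rewrite size_flatten /shape -map_comp sumnE big_map big_enum -an.
  by apply/eqP; apply: eq_bigr => x _ /=; rewrite size_nseq.
exists (tnth (Tuple szs)) => x.
have -> : fiber_card (tnth (Tuple szs)) x = count_mem x (Tuple szs).
  by rewrite fiber_cardE map_tnth_enum.
rewrite /= /s count_flatten -map_comp sumnE big_map big_enum /=.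
rewrite (bigD1 x) //= count_nseq /= eqxx mul1n big1 ?addn0 // => y yx.
by rewrite count_nseq /= (negPf yx).
Qed.

(** The permutations carrying [f] to [g] form the coset of [stab f] through [t]. *)
Lemma card_stab_transport (T : finType) (X : eqType) (f g : T -> X) (t : {perm T}) :
  (forall i, g i = f (t i)) ->
  #|[set s : {perm T} | [forall i, f (s i) == g i]]| = #|stab f|.
Proof.
move=> gt; rewrite -(card_imset (mem (stab f)) (mulgI t)) /=.
apply: eq_card => s; rewrite inE; apply/forallP/imsetP => [fs|[u /stabP fu ->] i].
  exists (t^-1 * s)%g; last by rewrite mulKVg.
  by apply/stabP => i; rewrite permM (eqP (fs _)) gt permKV.
by rewrite permM fu gt.
Qed.

Lemma fiber_card_sum (T : finType) (X : eqType) (f : T -> X) (x : X) :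
  fiber_card f x = \sum_(i | f i == x) 1.
Proof. by rewrite /fiber_card -sum1_card; apply: eq_bigl => i; rewrite inE. Qed.

Lemma sum_fiber_card (T X : finType) (f : T -> X) : \sum_x fiber_card f x = #|T|.
Proof.
rewrite -sum1_card (partition_big f xpredT) //=.
by apply: eq_bigr => x _; rewrite fiber_card_sum.
Qed.

Lemma sum_fiber_card_l (T : finType) (X : eqType) (Y : finType) (f : T -> X) (g : T -> Y) x :
  \sum_y fiber_card (fun i => (f i, g i)) (x, y) = fiber_card f x.
Proof.
rewrite fiber_card_sum (partition_big g xpredT) //=.
by apply: eq_bigr => y _; rewrite fiber_card_sum.
Qed.

Lemma sum_fiber_card_r (T : finType) (X : finType) (Y : eqType) (f : T -> X) (g : T -> Y) y :
  \sum_x fiber_card (fun i => (f i, g i)) (x, y) = fiber_card g y.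
Proof.
rewrite fiber_card_sum (partition_big f xpredT) //=.
by apply: eq_bigr => x _; rewrite fiber_card_sum; apply: eq_bigl => i; rewrite xpair_eqE andbC.
Qed.

Lemma fiber_card_perm (T : finType) (X : eqType) (f g : T -> X) (s : {perm T}) :
  (forall i, g i = f (s i)) -> forall x, fiber_card g x = fiber_card f x.
Proof.
move=> gs x; rewrite !fiber_card_sum [RHS](reindex_inj (@perm_inj _ s)).
by apply: eq_bigl => i; rewrite gs.
Qed.

Lemma eq_fiber_card (T : finType) (X : eqType) (f g : T -> X) :
  f =1 g -> fiber_card f =1 fiber_card g.
Proof. by move=> fg x; rewrite !fiber_card_sum; apply: eq_bigl => i; rewrite fg. Qed.

Lemma card_stab_fibers (T X : finType) (f g : T -> X) :
  fiber_card f =1 fiber_card g -> #|stab f| = #|stab g|.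
Proof.
move=> fg; rewrite !(@card_stab _ _ _ (enum X)) ?enum_uniq // => [|i|i];
  rewrite ?mem_enum //.
by apply: eq_bigr => x _; rewrite fg.
Qed.

(** Orbit counting for [stab w] acting on the maps [g] by precomposition. The matrix of joint fiber
    sizes of [w] and [g] is a complete invariant of the orbit, and the stabilizer of [g] is that of
    the paired map, so every matrix contributes [#|stab w|]. *)
Lemma sum_card_stab (n : nat) (X Y : finType) (w : 'I_n -> X) (b : Y -> nat) :
  \sum_(g : {ffun 'I_n -> Y} | [forall y, fiber_card g y == b y])
     #|stab (fun i => (w i, g i))| =
  #|stab w| * #|[set A : {ffun Y -> {ffun X -> 'I_n.+1}} |
     [forall y, \sum_x A y x == b y] && [forall x, \sum_y A y x == fiber_card w x]]|.
Proof.
have le_n (Z : eqType) (f : 'I_n -> Z) z : fiber_card f z < n.+1.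
  by rewrite ltnS (leq_trans (max_card _)) ?card_ord.
pose mat (g : {ffun 'I_n -> Y}) : {ffun Y -> {ffun X -> 'I_n.+1}} :=
  [ffun y => [ffun x => inord (fiber_card (fun i => (w i, g i)) (x, y))]].
have matE g y x : mat g y x = fiber_card (fun i => (w i, g i)) (x, y) :> nat.
  by rewrite !ffunE inordK.
set S := [set A | _].
rewrite (partition_big mat (mem S)) /=; last first.
  move=> g /forallP gb; rewrite inE; apply/andP; split; apply/forallP => z.
    by under eq_bigr do rewrite matE; rewrite sum_fiber_card_r.
  by under eq_bigr do rewrite matE; rewrite sum_fiber_card_l.
rewrite mulnC -sum_nat_const; apply: eq_bigr => A; rewrite inE => /andP[/forallP Ab /forallP Aw].
have Ap : \sum_(p : X * Y) A p.2 p.1 = n.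
  rewrite -(pair_bigA _ (fun x y => A y x : nat)) /=.
  under eq_bigr do rewrite (eqP (Aw _)).
  by rewrite sum_fiber_card card_ord.
(* Realize the matrix by a map to pairs and reindex it so that its first component is [w]. The
   second component is then a representative [g0] of the orbit. *)
have [f fA] := exists_fibers Ap.
have [s ws] : exists s : 'S_n, forall i, w i = (f (s i)).1.
  apply: (perm_of_fibers (f := fun i => (f i).1)) => x.
  rewrite -(sum_fiber_card_l (fun i => (f i).1) (fun i => (f i).2)) -(eqP (Aw x)).
  apply: eq_bigr => y _; rewrite -[RHS](fA (x, y)); apply: eq_fiber_card => i.
  by case: (f i).
pose g0 : {ffun 'I_n -> Y} := [ffun i => (f (s i)).2].
have g0A x y : fiber_card (fun i => (w i, g0 i)) (x, y) = A y x.
  rewrite -[RHS](fA (x, y)); apply: (fiber_card_perm (s := s)) => i.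
  by rewrite ws ffunE; case: (f _).
have eqmat g : (mat g == A) =
    [forall p, fiber_card (fun i => (w i, g i)) p == fiber_card (fun i => (w i, g0 i)) p].
  apply/eqP/forallP => [gA [x y]|H]; first by rewrite g0A -gA matE.
  apply/ffunP => y; apply/ffunP => x; apply: val_inj.
  by rewrite /= matE (eqP (H (x, y))) g0A.
rewrite -[RHS]sum1_card.
(* Split [stab w] by the translate of [g0] that a permutation produces; each class has the size of
   the stabilizer of the pair. *)
rewrite (partition_big (fun s : 'S_n => [ffun i => g0 (s i)])
  (fun g => [forall y, fiber_card g y == b y] && (mat g == A))) /=; last first.
  move=> t /stabP wt; apply/andP; split; last first.
    rewrite eqmat; apply/forallP => p; apply/eqP.
    by apply: (fiber_card_perm (s := t)) => i; rewrite ffunE wt.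
  apply/forallP => y; rewrite -(eqP (Ab y)) -(sum_fiber_card_r w).
  apply/eqP/eq_bigr => x _; rewrite -g0A.
  by apply: (fiber_card_perm (s := t)) => i; rewrite ffunE wt.
apply: eq_bigr => g /andP[_]; rewrite eqmat => /forallP gg0.
have /perm_of_fibers[t tE] p : fiber_card (fun i => (w i, g0 i)) p =
    fiber_card (fun i => (w i, g i)) p by rewrite (eqP (gg0 p)).
rewrite -(card_stab_fibers (f := fun i => (w i, g0 i))); last by move=> p; rewrite (eqP (gg0 p)).
rewrite -(card_stab_transport tE) sum1_card; apply: eq_card => u.
rewrite inE [RHS]inE /=; apply/forallP/andP => [H|[/stabP wu /eqP gu] i].
  split; first by apply/stabP => i; have /eqP[] := H i.
  by apply/eqP/ffunP => i; rewrite ffunE; have /eqP[] := H i.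
by rewrite wu -gu !ffunE.
Qed.

(** * Interlacing shapes and the Cauchy identity *)

Lemma card_bij (T U : finType) (A : {pred T}) (B : {pred U}) (f : T -> U) (g : U -> T) :
  (forall x, x \in A -> f x \in B /\ g (f x) = x) ->
  (forall y, y \in B -> g y \in A /\ f (g y) = y) -> #|A| = #|B|.
Proof.
have half (T1 U1 : finType) (A1 : {pred T1}) (B1 : {pred U1}) (f1 : T1 -> U1) (g1 : U1 -> T1) :
    (forall x, x \in A1 -> f1 x \in B1 /\ g1 (f1 x) = x) -> #|A1| <= #|B1|.
  move=> fA; rewrite -(card_in_imset (f := f1) (D := A1)); last first.
    by move=> x y /fA[_ {2}<-] /fA[_ {2}<-] ->.
  by apply/subset_leq_card/fintype.subsetP => _ /imsetP[x /fA[fB _] ->].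
by move=> /half fA /half gB; apply/eqP; rewrite eqn_leq fA gB.
Qed.

Definition ffun_rcons (T : Type) (m : nat) (f : {ffun 'I_m -> T}) (x : T) : {ffun 'I_m.+1 -> T} :=
  [ffun i => if unlift ord_max i is Some j then f j else x].

Lemma ffun_rcons_max (T : Type) (m : nat) (f : {ffun 'I_m -> T}) (x : T) :
  ffun_rcons f x ord_max = x.
Proof. by rewrite ffunE unlift_none. Qed.

Lemma ffun_rcons_widen (T : Type) (m : nat) (f : {ffun 'I_m -> T}) (x : T) (i : 'I_m) :
  ffun_rcons f x (widen_ord (leqnSn m) i) = f i.
Proof.
have -> : widen_ord (leqnSn m) i = lift ord_max i.
  by apply: val_inj; rewrite /= /bump leqNgt ltn_ord.
by rewrite ffunE liftK.
Qed.

Lemma sum_ffun_ordS (T : finType) (m : nat) (F : {ffun 'I_m.+1 -> T} -> nat) :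
  \sum_f F f = \sum_(x : T) \sum_(f : {ffun 'I_m -> T}) F (ffun_rcons f x).
Proof.
rewrite pair_big /= (reindex (fun p : T * {ffun 'I_m -> T} => ffun_rcons p.2 p.1)) //=.
exists (fun f => (f ord_max, [ffun i => f (widen_ord (leqnSn m) i)])) => [[x f] _|f _] /=.
  rewrite ffun_rcons_max; congr pair; apply/ffunP => i.
  by rewrite ffunE ffun_rcons_widen.
apply/ffunP => i; rewrite ffunE; case: unliftP => [j ->|-> //].
by rewrite ffunE; congr (f _); apply: val_inj; rewrite /= /bump leqNgt ltn_ord.
Qed.

(** The default 0 lets the interlacing inequalities be stated for all indices, without boundary
    cases. *)
Definition ffun_nat (m N : nat) (c : {ffun 'I_m -> 'I_N}) (i : nat) : nat :=
  oapp (fun j => c j : nat) 0 (insub i).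

Lemma ffun_natE (m N : nat) (c : {ffun 'I_m -> 'I_N}) (i : 'I_m) : ffun_nat c i = c i.
Proof. by rewrite /ffun_nat valK. Qed.

Lemma ffun_nat_out (m N : nat) (c : {ffun 'I_m -> 'I_N}) (i : nat) : m <= i -> ffun_nat c i = 0.
Proof. by move=> mi; rewrite /ffun_nat insubN // -leqNgt. Qed.

Lemma ffun_nat_rcons (m N : nat) (c : {ffun 'I_m -> 'I_N}) (x : 'I_N) (i : nat) :
  i <= m -> ffun_nat (ffun_rcons c x) i = if i < m then ffun_nat c i else x.
Proof.
move=> im; case: ltnP => [lt_im|mi].
  have -> : i = widen_ord (leqnSn m) (Ordinal lt_im) by [].
  by rewrite ffun_natE ffun_rcons_widen -ffun_natE.
have -> : i = @ord_max m by apply/eqP; rewrite eqn_leq im mi.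
by rewrite ffun_natE ffun_rcons_max.
Qed.

Lemma ffun_nat_inj (m N : nat) (c d : {ffun 'I_m -> 'I_N}) :
  (forall i, i < m -> ffun_nat c i = ffun_nat d i) -> c = d.
Proof. by move=> cd; apply/ffunP => i; apply: val_inj; rewrite /= -!ffun_natE cd. Qed.

(* Row lengths, with [ffun_nat l i = 0] for [i > n]. A shape is not required to be
   weakly decreasing: [strip k l] (l/k is a horizontal strip) forces it for both. *)
Notation shape n := {ffun 'I_n.+1 -> 'I_n.+1}.

Definition weight (n : nat) (l : shape n) : nat := \sum_(i < n.+1) ffun_nat l i.

Definition strip (n : nat) (k l : shape n) : bool :=
  [forall i : 'I_n.+1, ffun_nat l i.+1 <= ffun_nat k i <= ffun_nat l i].

Definition step (n : nat) (c : nat) (k l : shape n) : bool :=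
  strip k l && (weight l == weight k + c).

(* The number of chains from the empty shape to [l] adding horizontal strips of
   sizes [a 0], ..., [a m.-1]: a Kostka number, by [card_tableaux_paths]. *)
Fixpoint paths (n m : nat) (a : nat -> nat) (l : shape n) : nat :=
  if m is m'.+1 then \sum_(k | step (a m') k l) paths m' a k else weight l == 0.

Lemma stripP (n : nat) (k l : shape n) :
  reflect (forall i, ffun_nat l i.+1 <= ffun_nat k i <= ffun_nat l i) (strip k l).
Proof.
apply: (iffP forallP) => [H i|H i]; last exact: H.
case: (ltnP i n.+1) => [lt_i|le_i]; first exact: (H (Ordinal lt_i)).
by rewrite !ffun_nat_out // ltnW.
Qed.

(** [inord] sends values above [n] to 0, so every use has to bound [h] first. *)
Definition mk_shape (n : nat) (h : nat -> nat) : shape n := [ffun i : 'I_n.+1 => inord (h i)].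

Lemma mk_shapeE (n : nat) (h : nat -> nat) (i : nat) :
  i <= n -> h i <= n -> ffun_nat (mk_shape n h) i = h i.
Proof.
move=> lt_i hi; have -> : i = Ordinal (lt_i : i < n.+1) by [].
by rewrite ffun_natE ffunE inordK.
Qed.

Lemma ffun_nat_le (n m : nat) (l : {ffun 'I_m -> 'I_n.+1}) i : ffun_nat l i <= n.
Proof. by rewrite /ffun_nat; case: insub => //= j; rewrite -ltnS. Qed.

Lemma weight_strip (n : nat) (k l : shape n) : strip k l -> weight k <= weight l.
Proof. by move=> /stripP kl; apply: leq_sum => i _; case/andP: (kl i). Qed.

(** Rows weakly decrease, so a nonempty row of index [n] would force [n.+1] nonempty rows. A shape
    of weight at most [n] thus stays away from the edge of the index range. *)
Lemma last_row0 (n : nat) (k l : shape n) : strip k l -> weight l <= n -> ffun_nat l n = 0.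
Proof.
move=> /stripP kl wl; apply/eqP; rewrite -leqn0 leqNgt; apply/negP => ln.
have dec d i : ffun_nat l (i + d) <= ffun_nat l i.
  elim: d => [|d IH]; first by rewrite addn0.
  apply: leq_trans IH; rewrite addnS; have /andP[h1 h2] := kl (i + d).
  exact: leq_trans h2.
move: wl; rewrite leqNgt => /negP[]; rewrite /weight.
apply: (@leq_trans (\sum_(i < n.+1) 1)); first by rewrite sum1_card card_ord.
apply: leq_sum => i _; apply: leq_trans ln _.
by have := dec (n - i) i; rewrite subnKC // -ltnS.
Qed.

(** * The local rule exchanging two horizontal strips *)

Section LocalRule.
Variables (n : nat) (l u : shape n) (a b : nat).
Hypotheses (wua : weight u + a <= n) (wlu : weight l + b = weight u + a).

Let mx i := maxn (ffun_nat l i) (ffun_nat u i).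
Let mn i := minn (ffun_nat l i) (ffun_nat u i).

(* The local rule of RSK: the value of the first row is the only one not confined
   to an interval by [l] and [u], and is fixed by the size. *)
Let up (k : shape n) := mk_shape n (fun i =>
  if i is j.+1 then mx i + mn j - ffun_nat k j else mx 0 + (a + weight k - weight l)).
Let down (v : shape n) := mk_shape n (fun i => mx i.+1 + mn i - ffun_nat v i.+1).

Let sum_mx_mn : \sum_(i < n.+1) mx i + \sum_(i < n.+1) mn i = weight l + weight u.
Proof.
by rewrite /weight -!big_split; apply: eq_bigr => i _; rewrite /= /mx /mn; lia.
Qed.

(** If [k] lies below [l] and [u], then [k i] is confined to the interval from [mx i.+1] to [mn i];
    if [v] lies above them, [v i.+1] is confined to the same interval. [up] and [down] reflect this
    interval onto itself, hence are mutually inverse. *)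
Let upE k : strip k l -> strip k u -> weight l <= weight k + a ->
  [/\ ffun_nat (up k) 0 = mx 0 + (a + weight k - weight l),
      forall i, ffun_nat (up k) i.+1 = mx i.+1 + mn i - ffun_nat k i
    & weight (up k) = weight l + b].
Proof.
move=> kl ku wk; have /stripP kl' := kl; have /stripP ku' := ku.
pose h i := if i is j.+1 then mx i + mn j - ffun_nat k j else mx 0 + (a + weight k - weight l).
have kb i : mx i.+1 <= ffun_nat k i <= mn i.
  by rewrite geq_max leq_min; have /andP[-> ->] := kl' i; have /andP[-> ->] := ku' i.
have wll : weight l <= n.
  have := weight_strip ku; have := weight_strip kl; lia.
(* With the last rows empty, the shift from [k i] to row [i.+1] of [up k] loses nothing in the
   sums. *)
have mn_n : mn n = 0 by rewrite /mn (last_row0 kl wll) min0n.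
have k_n : ffun_nat k n = 0 by have := kb n; lia.
have sum_h : \sum_(i < n.+1) h i = weight l + b.
  have recl (f : nat -> nat) : \sum_(i < n.+1) f i = f 0 + \sum_(i < n) f i.+1.
    by rewrite big_ord_recl.
  have E : \sum_(i < n) h i.+1 + \sum_(i < n.+1) ffun_nat k i =
           \sum_(i < n) mx i.+1 + \sum_(i < n.+1) mn i.
    rewrite big_ord_recr [in RHS]big_ord_recr /= k_n mn_n !addn0 -!big_split.
    by apply: eq_bigr => i _ /=; have := kb i; lia.
  have h0 : h 0 = mx 0 + (a + weight k - weight l) by [].
  move: sum_mx_mn E; rewrite (recl h) (recl mx) h0 -/(weight k).
  have := weight_strip kl; lia.
(* No entry exceeds the total, which is at most [n], so [mk_shape] does not truncate. *)
have hle i : i <= n -> h i <= n.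
  move=> lt_i; apply: leq_trans (_ : weight l + b <= n); last by rewrite wlu.
  by rewrite -sum_h (bigD1 (Ordinal (lt_i : i < n.+1))) //= leq_addr.
have hE i : i <= n -> ffun_nat (up k) i = h i by move=> lt_i; rewrite mk_shapeE // hle.
split; first exact: hE.
  move=> i; case: (leqP i.+1 n) => [/hE //|lt_i].
  have mn0 : mn i = 0.
    rewrite ltnS in lt_i; case: (ltngtP n i) lt_i => // [n_i _|<- _ //].
    by rewrite /mn !ffun_nat_out.
  have mx0 : mx i.+1 = 0 by rewrite /mx !(@ffun_nat_out _ _ _ i.+1).
  by rewrite mn0 mx0 ffun_nat_out.
by rewrite -sum_h; apply: eq_bigr => i _; rewrite hE // -ltnS.
Qed.

Let downE v : strip l v -> strip u v -> weight v = weight l + b ->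
  (forall i, ffun_nat (down v) i + ffun_nat v i.+1 = mx i.+1 + mn i) /\
  weight (down v) + a + mx 0 = weight l + ffun_nat v 0.
Proof.
move=> /stripP lv /stripP uv wv.
have vb i : mx i <= ffun_nat v i /\ ffun_nat v i.+1 <= mn i.
  by rewrite geq_max leq_min; have /andP[-> ->] := lv i; have /andP[-> ->] := uv i.
have vE i : ffun_nat (down v) i + ffun_nat v i.+1 = mx i.+1 + mn i.
  have [[h1 _] [_ h2]] := (vb i.+1, vb i).
  case: (leqP i n) => [le_i|lt_i]; last first.
    by rewrite /mx /mn !ffun_nat_out // ltnW.
  rewrite mk_shapeE //; first by lia.
  by have : mn i <= n; [rewrite geq_min ffun_nat_le | lia].
split=> //.
have : weight (down v) + \sum_(i < n.+1) ffun_nat v i.+1 =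
    \sum_(i < n.+1) mx i.+1 + \sum_(i < n.+1) mn i.
  by rewrite -!big_split; apply: eq_bigr => i _ /=; rewrite vE.
have shift (f : nat -> nat) : f n.+1 = 0 -> f 0 + \sum_(i < n.+1) f i.+1 = \sum_(i < n.+1) f i.
  by move=> f0; rewrite big_ord_recr /= f0 addn0 [RHS]big_ord_recl.
have mx0 : mx n.+1 = 0 by rewrite /mx !ffun_nat_out.
have := shift mx mx0.
have := shift (ffun_nat v); rewrite ffun_nat_out // -/(weight v) => /(_ erefl).
by move: sum_mx_mn wv; lia.
Qed.

Lemma card_strip_exchange :
  #|[pred v | [&& strip l v, strip u v & weight v == weight l + b]]| =
  #|[pred k | [&& strip k l, strip k u & weight l <= weight k + a]]|.
Proof.
apply: (card_bij (f := down) (g := up)) => [v|k]; rewrite !inE.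
  case/and3P => lv uv /eqP wv; have [dE dw] := downE lv uv wv.
  have /stripP lv' := lv; have /stripP uv' := uv.
  have dl : strip (down v) l.
    by apply/stripP => i; move: (lv' i) (uv' i) (lv' i.+1) (uv' i.+1) (dE i); rewrite /mx /mn; lia.
  have du : strip (down v) u.
    by apply/stripP => i; move: (lv' i) (uv' i) (lv' i.+1) (uv' i.+1) (dE i); rewrite /mx /mn; lia.
  have dwl : weight l <= weight (down v) + a.
    by move: (lv' 0) (uv' 0) dw; rewrite /mx; lia.
  split; first by rewrite dl du dwl.
  have [e0 eS _] := upE dl du dwl.
  apply: ffun_nat_inj => -[|i] _; first by rewrite e0; lia.
  by rewrite eS -dE addKn.
case/and3P => kl ku wk; have [e0 eS ew] := upE kl ku wk.
have /stripP kl' := kl; have /stripP ku' := ku.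
have lu0 : strip l (up k).
  apply/stripP => -[|i].
    by rewrite e0 eS; move: (kl' 0) (ku' 0); rewrite /mx /mn; lia.
  by rewrite !eS; move: (kl' i) (ku' i) (kl' i.+1) (ku' i.+1); rewrite /mx /mn; lia.
have uu0 : strip u (up k).
  apply/stripP => -[|i].
    by rewrite e0 eS; move: (kl' 0) (ku' 0); rewrite /mx /mn; lia.
  by rewrite !eS; move: (kl' i) (ku' i) (kl' i.+1) (ku' i.+1); rewrite /mx /mn; lia.
split; first by rewrite lu0 uu0 ew eqxx.
have [dE _] := downE lu0 uu0 ew.
apply: ffun_nat_inj => i _; move: (dE i); rewrite eS.
by move: (kl' i) (ku' i); rewrite /mx /mn; lia.
Qed.

End LocalRule.

(** For the operators U and D adding and removing horizontal strips this reads D_b U_a = sum_c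
    U_(a-c) D_(b-c). The index [c] is the excess of the first row of [v] over [mx 0] in the local
    rule. *)
Lemma step_exchange (n : nat) (l u : shape n) (a b : nat) :
  weight u + a <= n ->
  \sum_(v | step a u v) (step b l v : nat) =
  \sum_(c < n.+1 | (c <= a) && (c <= b)) \sum_(k | step (a - c) k l) (step (b - c) k u : nat).
Proof.
move=> wua; case: (eqVneq (weight l + b) (weight u + a)) => [wlu|nlu]; last first.
  rewrite !big1 //.
    move=> c /andP[ca cb]; rewrite big1 // => k /andP[_ /eqP wl].
    apply/eqP; rewrite eqb0 /step; apply/negP => /andP[_ /eqP wu].
    by case/eqP: nlu; rewrite wl wu; lia.
  move=> v /andP[_ /eqP wu]; apply/eqP; rewrite eqb0 /step; apply/negP => /andP[_ /eqP wl].
  by case/eqP: nlu; rewrite -wl -wu.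
transitivity #|[pred v | [&& strip l v, strip u v & weight v == weight l + b]]|.
  rewrite -sum1_card big_mkcond [RHS]big_mkcond; apply: eq_bigr => v _ /=.
  by rewrite inE /step wlu; case: (strip u v); case: (strip l v); case: (_ == _).
rewrite (card_strip_exchange wua wlu) -sum1_card.
rewrite (exchange_big_dep xpredT) //= big_mkcond; apply: eq_bigr => k _ /=.
rewrite inE /=; case: ifP => [/and3P[kl ku wk]|nk]; last first.
  rewrite big1 // => c /andP[/andP[ca cb] /andP[kl /eqP wl]].
  apply/eqP; rewrite eqb0 /step; apply/negP => /andP[ku _].
  by move: nk; rewrite kl ku wl; lia.
have := weight_strip kl; have := weight_strip ku => wku wkl.
(* The weight of [k] leaves only this [c]. *)
have lt_c : a + weight k - weight l < n.+1 by lia.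
rewrite (bigD1 (Ordinal lt_c)) /=; last by rewrite /step kl /=; lia.
rewrite {1}/step ku /= big1 ?addn0; first by rewrite (_ : _ == _ = true) //; lia.
move=> c /andP[/andP[/andP[ca cb] /andP[_ /eqP wl]] /eqP[]].
by apply: val_inj => /=; lia.
Qed.

(** * Chain counts, the Cauchy identity and the symmetry of Kostka numbers *)

Lemma eq_paths (n m : nat) (a a' : nat -> nat) (l : shape n) :
  (forall i, i < m -> a i = a' i) -> paths m a l = paths m a' l.
Proof.
elim: m l => [//|m IH] l aa'; rewrite /= aa' //; apply: eq_bigr => k _.
by apply: IH => i im; apply/aa'/ltnW.
Qed.

Lemma paths_weight (n m : nat) (a : nat -> nat) (l : shape n) :
  paths m a l != 0 -> weight l = \sum_(i < m) a i.
Proof.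
elim: m l => [|m IH] l /=; first by rewrite big_ord0 eqb0 negbK => /eqP.
rewrite sum_nat_eq0 negb_forall => /existsP[k]; rewrite negb_imply => /andP[/andP[_ /eqP ->]].
by move=> /IH ->; rewrite big_ord_recr.
Qed.

(** [c i] is the part of the [i]-th added strip that cancels against a removed strip of size [b];
    such a [c] becomes one row of the matrix in [cauchy]. *)
Definition below (n m : nat) (a : nat -> nat) (b : nat) (c : {ffun 'I_m -> 'I_n.+1}) : bool :=
  [forall i : 'I_m, c i <= a i] && (\sum_(i < m) c i == b).

Lemma below_rcons (n m : nat) (a : nat -> nat) (b : nat) (c : {ffun 'I_m -> 'I_n.+1}) (x : 'I_n.+1) :
  below a b (ffun_rcons c x) = [&& x <= a m, x <= b & below a (b - x) c].
Proof.
rewrite /below big_ord_recr /= ffun_rcons_max.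
under eq_bigr do rewrite ffun_rcons_widen.
have -> : [forall i, ffun_rcons c x i <= a i] = (x <= a m) && [forall i : 'I_m, c i <= a i].
  apply/forallP/andP => [H|[xa /forallP H] i].
    split; first by have := H ord_max; rewrite ffun_rcons_max.
    by apply/forallP => i; have := H (widen_ord (leqnSn m) i); rewrite ffun_rcons_widen.
  case: (unliftP ord_max i) => [j ->|->]; last by rewrite ffun_rcons_max.
  have -> : lift ord_max j = widen_ord (leqnSn m) j.
    by apply: val_inj; rewrite /= /bump leqNgt ltn_ord.
  by rewrite ffun_rcons_widen.
by case: (x <= a m); case: [forall _, _] => //=; lia.
Qed.

(** The removal of a strip of size [b] is commuted past the [m] additions, last one first. When it
    reaches the empty shape only the size 0 survives, so the cancelled parts must sum to [b]. *)
Lemma paths_down (n m : nat) (a : nat -> nat) (b : nat) (k : shape n) :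
  \sum_(i < m) a i <= n ->
  \sum_l step b k l * paths m a l =
  \sum_(c : {ffun 'I_m -> 'I_n.+1} | below a b c) paths m (fun i => a i - ffun_nat c i) k.
Proof.
elim: m b k => [|m IH] b k an.
  have eS (P : pred {ffun 'I_0 -> 'I_n.+1}) F :
      \sum_(c | P c) F c = P [ffun i => ord0] * F [ffun i => ord0] :> nat.
    rewrite big_mkcond (big_pred1 [ffun i => ord0]) => [|c].
      by case: (P _); rewrite ?mul1n.
    by apply/esym/eqP/ffunP => -[].
  rewrite eS /below big_ord0 /=.
  rewrite (_ : [forall _, _] = true) /=; last by apply/forallP => -[].
  pose z : shape n := [ffun i => ord0].
  have z0 i : ffun_nat z i = 0 by rewrite /ffun_nat; case: insub => //= j; rewrite ffunE.
  have wz l : (weight l == 0) = (l == z).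
    rewrite /weight sum_nat_eq0; apply/forallP/eqP => [H|-> i]; last by rewrite z0.
    by apply: ffun_nat_inj => i lt_i; rewrite z0; apply/eqP; apply: (H (Ordinal lt_i)).
  rewrite (bigD1 z) //= big1 ?addn0; last by move=> l /negPf lz; rewrite wz lz muln0.
  rewrite wz eqxx muln1 /step.
  have wz0 : weight z = 0 by apply/eqP; rewrite wz.
  have sz : strip z z by apply/stripP => i; rewrite !z0.
  case: (eqVneq (weight k) 0) => wk; last first.
    by rewrite muln0 wz0; case: strip => //=; move: wk; lia.
  by move/eqP: wk; rewrite wz => /eqP ->; rewrite sz wz0 add0n muln1.
rewrite big_ord_recr /= in an.
have am : \sum_(i < m) a i <= n by apply: leq_trans an; rewrite leq_addr.
transitivity (\sum_u paths m a u * \sum_(l | step (a m) u l) step b k l).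
  under eq_bigr do rewrite /= big_distrr /= big_mkcond /=.
  rewrite exchange_big; apply: eq_bigr => u _.
  by rewrite big_distrr /= [RHS]big_mkcond; apply: eq_bigr => l _; case: ifP => // _; rewrite mulnC.
transitivity (\sum_u paths m a u *
   \sum_(c < n.+1 | (c <= a m) && (c <= b)) \sum_(k' | step (a m - c) k' k) step (b - c) k' u).
  (* The size bound of [step_exchange] holds only for shapes that a chain reaches; the others
     contribute 0. *)
  apply: eq_bigr => u _; case: (eqVneq (paths m a u) 0) => [->|pu]; first by rewrite !mul0n.
  by rewrite step_exchange // (paths_weight pu).
under eq_bigr do rewrite big_distrr /=.
rewrite exchange_big /= [RHS]big_mkcond sum_ffun_ordS /= big_mkcond.
apply: eq_bigr => x _; under [RHS]eq_bigr do rewrite below_rcons andbA.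
case: (_ && _) => /=; last by rewrite big1.
under eq_bigr do rewrite big_distrr /=.
rewrite exchange_big /= -big_mkcond exchange_big /=.
have rm (c : {ffun 'I_m -> 'I_n.+1}) : a m - ffun_nat (ffun_rcons c x) m = a m - x.
  by rewrite ffun_nat_rcons // ltnn.
under [RHS]eq_bigr do rewrite rm.
rewrite [LHS](exchange_big_dep (fun k0 => step (a m - x) k0 k)) //= [RHS](exchange_big_dep (fun k0 => step (a m - x) k0 k)) //=.
apply: eq_bigr => k' sk.
transitivity (\sum_u step (b - x) k' u * paths m a u).
  by apply: eq_big => u; rewrite ?sk // => _; rewrite mulnC.
rewrite IH //; apply: eq_big => c; rewrite ?sk ?andbT // => _; apply: eq_paths => i im.
by rewrite ffun_nat_rcons ?im // ltnW.
Qed.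

Definition margins (n m k : nat) (a b : nat -> nat) (A : {ffun 'I_k -> {ffun 'I_m -> 'I_n.+1}}) : bool :=
  [forall j : 'I_k, \sum_(i < m) A j i == b j] && [forall i : 'I_m, \sum_(j < k) A j i == a i].

Lemma card_set_sum (T : finType) (P : pred T) : #|[set x | P x]| = \sum_x (P x : nat).
Proof.
rewrite -sum1_card big_mkcond; apply: eq_bigr => x _.
by rewrite inE; case: (P x).
Qed.

Lemma weight0 (n : nat) (l : shape n) : (weight l == 0) = (l == [ffun i => ord0]).
Proof.
pose z : shape n := [ffun i => ord0].
have z0 i : ffun_nat z i = 0 by rewrite /ffun_nat; case: insub => //= j; rewrite ffunE.
rewrite /weight sum_nat_eq0; apply/forallP/eqP => [H|-> i]; last by rewrite z0.
by apply: ffun_nat_inj => i lt_i; rewrite z0; apply/eqP; apply: (H (Ordinal lt_i)).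
Qed.

Lemma paths_weight0 (n m : nat) (a : nat -> nat) (l : shape n) :
  weight l = 0 -> paths m a l = [forall i : 'I_m, 0 == a i].
Proof.
move/eqP; rewrite weight0 => /eqP ->; set z := finfun _.
have wz : weight z = 0 by apply/eqP; rewrite weight0.
elim: m => [|m IH] /=; first by rewrite wz eqxx; apply/esym/eqP; rewrite eqb1; apply/forallP => -[].
have sz : strip z z.
  by apply/stripP => i; rewrite /ffun_nat; do 2 case: insub => [?|] //=; rewrite !ffunE.
rewrite big_mkcond (bigD1 z) //= big1 ?addn0 => [|k kz]; last first.
  rewrite /step wz (_ : (0 == _) = false) ?andbF //.
  by move: kz; rewrite -weight0; lia.
rewrite /step sz wz add0n IH /=.
have -> : [forall i : 'I_m.+1, 0 == a i] = (0 == a m) && [forall i : 'I_m, 0 == a i].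
  apply/forallP/andP => [H|[am /forallP H] i].
    by split; [exact: (H ord_max)|apply/forallP => i; exact: (H (widen_ord (leqnSn m) i))].
  case: (unliftP ord_max i) => [j ->|-> //].
  by have := H j; rewrite /= /bump leqNgt ltn_ord.
by case: (0 == a m).
Qed.

(** A pair of chains with common end is read as [m] additions followed by [k] removals. Pushing a
    removal down with [paths_down] produces a row of the matrix and subtracts it from the column
    margins [a]. *)
Lemma cauchy (n m k : nat) (a b : nat -> nat) :
  \sum_(i < m) a i <= n ->
  \sum_(l : shape n) paths m a l * paths k b l =
    #|[set A : {ffun 'I_k -> {ffun 'I_m -> 'I_n.+1}} | margins a b A]|.
Proof.
elim: k a => [|k IH] a an /=.
  rewrite (bigD1 [ffun i => ord0]) //= big1 ?addn0 => [|l]; last first.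
    by rewrite -weight0 => /negPf ->; rewrite muln0.
  rewrite weight0 eqxx muln1 paths_weight0; last by apply/eqP; rewrite weight0.
  pose A0 : {ffun 'I_0 -> {ffun 'I_m -> 'I_n.+1}} := [ffun _ => [ffun _ => ord0]].
  rewrite card_set_sum (big_pred1 A0) /= => [|A]; last by apply/esym/eqP/ffunP => -[].
  rewrite /margins.
  rewrite (_ : [forall j : 'I_0, _] = true) /=; last by apply/forallP => -[].
  rewrite (_ : [forall i : 'I_m, \sum_(j < 0) A0 j i == a i] = [forall i : 'I_m, 0 == a i]).
    by case: [forall i, _].
  by apply: eq_forallb => i; rewrite big_ord0.
transitivity (\sum_(u : shape n) paths k b u * \sum_l step (b k) u l * paths m a l).
  under eq_bigr do rewrite big_distrr /= big_mkcond /=.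
  rewrite exchange_big; apply: eq_bigr => u _; rewrite big_distrr /=.
  by apply: eq_bigr => l _; case: ifP => _; rewrite ?mul0n ?muln0 // mul1n mulnC.
under eq_bigr do rewrite paths_down // big_distrr /=.
rewrite exchange_big /= card_set_sum sum_ffun_ordS big_mkcond /=.
apply: eq_bigr => c _.
have margins_rcons (A : {ffun 'I_k -> {ffun 'I_m -> 'I_n.+1}}) : margins a b (ffun_rcons A c) =
    below a (b k) c && margins (fun i => a i - ffun_nat c i) b A.
  rewrite /margins /below.
  have -> : [forall j : 'I_k.+1, \sum_(i < m) ffun_rcons A c j i == b j] =
      (\sum_(i < m) c i == b k) && [forall j : 'I_k, \sum_(i < m) A j i == b j].
    apply/forallP/andP => [H|[ck /forallP H] j].
      split; first by have := H ord_max; rewrite ffun_rcons_max.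
      by apply/forallP => j; have := H (widen_ord (leqnSn k) j); rewrite ffun_rcons_widen.
    case: (unliftP ord_max j) => [i ->|->]; last by rewrite ffun_rcons_max.
    have -> : lift ord_max i = widen_ord (leqnSn k) i.
      by apply: val_inj; rewrite /= /bump leqNgt ltn_ord.
    by rewrite ffun_rcons_widen; exact: H.
  have -> : [forall i : 'I_m, \sum_(j < k.+1) ffun_rcons A c j i == a i] =
      [forall i : 'I_m, c i <= a i] && [forall i : 'I_m, \sum_(j < k) A j i == a i - ffun_nat c i].
    rewrite -[RHS]/(_ && _); apply/forallP/andP => [H|[/forallP H1 /forallP H2] i].
      by split; apply/forallP => i; have := H i;
        rewrite big_ord_recr /= ffun_rcons_max;
        under eq_bigr do rewrite ffun_rcons_widen; rewrite ?ffun_natE; lia.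
    rewrite big_ord_recr /= ffun_rcons_max; under eq_bigr do rewrite ffun_rcons_widen.
    by move: (H1 i) (H2 i); rewrite ffun_natE => h /eqP ->; rewrite subnK.
  by case: (\sum_(i < m) c i == b k); case: [forall i : 'I_m, c i <= a i]; rewrite ?andbF ?andbT.
under [RHS]eq_bigr do rewrite margins_rcons.
case: ifP => /= [_|_]; last by rewrite big1.
under eq_bigr do rewrite mulnC.
rewrite IH; last by apply: leq_trans an; apply: leq_sum => i _; apply: leq_subr.
by rewrite card_set_sum.
Qed.

Lemma card_margins_perm (n m k : nat) (a a' b b' : nat -> nat) (s : 'S_m) (t : 'S_k) :
  (forall i, a' (i : 'I_m) = a (s i)) -> (forall j, b' (j : 'I_k) = b (t j)) ->
  #|[set A : {ffun 'I_k -> {ffun 'I_m -> 'I_n.+1}} | margins a' b' A]| =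
  #|[set A : {ffun 'I_k -> {ffun 'I_m -> 'I_n.+1}} | margins a b A]|.
Proof.
move=> sa tb.
pose act (s : 'S_m) (t : 'S_k) (A : {ffun 'I_k -> {ffun 'I_m -> 'I_n.+1}}) :
  {ffun 'I_k -> {ffun 'I_m -> 'I_n.+1}} := [ffun j => [ffun i => A (t j) (s i)]].
have actV (s1 : 'S_m) (t1 : 'S_k) A : act s1^-1%g t1^-1%g (act s1 t1 A) = A.
  by apply/ffunP => j; apply/ffunP => i; rewrite !ffunE !permKV.
have actM (a1 b1 a2 b2 : nat -> nat) (s1 : 'S_m) (t1 : 'S_k) A :
    (forall i, a2 (i : 'I_m) = a1 (s1 i)) -> (forall j, b2 (j : 'I_k) = b1 (t1 j)) ->
    margins a1 b1 A -> margins a2 b2 (act s1 t1 A).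
  move=> sa1 tb1 /andP[/forallP Hb /forallP Ha]; apply/andP; split; apply/forallP => i.
    rewrite tb1 -(eqP (Hb (t1 i))) [X in _ == X](reindex_inj (@perm_inj _ s1)).
    by apply/eqP/eq_bigr => j _; rewrite !ffunE.
  rewrite sa1 -(eqP (Ha (s1 i))) [X in _ == X](reindex_inj (@perm_inj _ t1)).
  by apply/eqP/eq_bigr => j _; rewrite !ffunE.
apply: (card_bij (f := act s^-1%g t^-1%g) (g := act s t)) => A; rewrite !inE => mA; split.
- by apply: actM mA => i; rewrite ?sa ?tb permKV.
- by rewrite -{1}[s]invgK -{1}[t]invgK actV.
- exact: actM mA.
- exact: actV.
Qed.

(* By the Cauchy identity, [\sum_l (paths m a l - paths m a' l) ^ 2 = 0]. *)
Lemma paths_perm (n m : nat) (a a' : nat -> nat) (s : 'S_m) (l : shape n) :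
  \sum_(i < m) a i <= n -> (forall i, a' (i : 'I_m) = a (s i)) ->
  paths m a' l = paths m a l.
Proof.
move=> an sa.
have a'n : \sum_(i < m) a' i <= n.
  rewrite (leq_trans _ an) // [X in _ <= X](reindex_inj (@perm_inj _ s)) leq_eqVlt.
  by apply/orP; left; apply/eqP/eq_bigr => i _; rewrite sa.
have e1 i : a (i : 'I_m) = a ((1%g : 'S_m) i) by rewrite perm1.
have C1 := @cauchy n m m a a an.
have C2 := @cauchy n m m a' a a'n.
have C3 := @cauchy n m m a' a' a'n.
rewrite (card_margins_perm n sa e1) -C1 in C2.
rewrite (card_margins_perm n sa sa) -C1 in C3.
(* To avoid subtraction in nat, the argument uses the equality case of 2xy <= x^2 + y^2, which
   passes from the sum to each term. *)
have H (i : shape n) : true -> 2 * (paths m a' i * paths m a i) <=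
    paths m a' i ^ 2 + paths m a i ^ 2 ?= iff (paths m a' i == paths m a i).
  by move=> _; apply: nat_Cauchy.
have := leqif_sum H; rewrite -big_distrr big_split /= C2.
rewrite (eq_bigr _ (fun i _ => esym (mulnn (paths m a' i)))) C3.
rewrite (eq_bigr _ (fun i _ => esym (mulnn (paths m a i)))) mul2n addnn => /leqif_refl.
by move/forallP => /(_ l)/eqP.
Qed.

Lemma strip_eq_weight (n : nat) (k l : shape n) : strip k l -> weight k = weight l -> k = l.
Proof.
move=> /stripP kl wkl; apply: ffun_nat_inj => i lt_i.
have H (j : 'I_n.+1) : true -> ffun_nat k j <= ffun_nat l j ?= iff (ffun_nat k j == ffun_nat l j).
  by move=> _; split=> //; case/andP: (kl j).
have := leqif_sum H; rewrite -/(weight k) -/(weight l) wkl => /leqif_refl/forallP/(_ (Ordinal lt_i)).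
by move/eqP.
Qed.

(** [strip l l] says that the rows of [l] weakly decrease, so it singles out the genuine partitions
    among the shapes. *)
Lemma paths_strip (n m : nat) (a : nat -> nat) (l : shape n) : paths m a l != 0 -> strip l l.
Proof.
case: m => [|m] /=.
  rewrite eqb0 negbK weight0 => /eqP ->; apply/stripP => i.
  by rewrite /ffun_nat; do 2 case: insub => [?|] //=; rewrite !ffunE.
rewrite sum_nat_eq0 negb_forall => /existsP[k]; rewrite negb_imply => /andP[/andP[/stripP kl _] _].
by apply/stripP => i; rewrite leqnn andbT; have /andP[h1 h2] := kl i; apply: leq_trans h2.
Qed.

(** An empty strip leaves the shape unchanged. Padding brings contents of different lengths to a
    common length, as [paths_perm] requires. *)
Lemma paths_pad (n m d : nat) (a : nat -> nat) (l : shape n) :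
  (forall i, m <= i -> a i = 0) -> paths (m + d) a l = paths m a l.
Proof.
move=> a0; elim: d l => [|d IH] l; first by rewrite addn0.
rewrite addnS /= a0 ?leq_addr //.
have -> : paths m a l = strip l l * paths m a l.
  case: (boolP (strip l l)) => [|ll]; first by rewrite mul1n.
  by rewrite mul0n; apply/eqP; apply: contraNT ll; apply: paths_strip.
rewrite big_mkcond (bigD1 l) //= big1 ?addn0 => [|k kl]; last first.
  case: ifP => // /andP[kl']; rewrite addn0 eq_sym => /eqP /(strip_eq_weight kl') kl2.
  by rewrite kl2 eqxx in kl.
by rewrite /step addn0 eqxx andbT IH; case: (strip l l); rewrite ?mul1n ?mul0n.
Qed.

(** * Tableaux as chains of shapes *)

(** [G] stores only the shapes before the last one; the default value supplies the fixed end [l] at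
    index [m]. *)
Definition chain_at (n m : nat) (G : {ffun 'I_m -> shape n}) (l : shape n) (j : nat) : shape n :=
  oapp G l (insub j).

Lemma chain_at_lt (n m : nat) (G : {ffun 'I_m -> shape n}) (l : shape n) (j : 'I_m) :
  chain_at G l j = G j.
Proof. by rewrite /chain_at valK. Qed.

Lemma chain_at_last (n m : nat) (G : {ffun 'I_m -> shape n}) (l : shape n) : chain_at G l m = l.
Proof. by rewrite /chain_at insubN // ltnn. Qed.

Definition chain (n m : nat) (a : nat -> nat) (l : shape n) (G : {ffun 'I_m -> shape n}) : bool :=
  (weight (chain_at G l 0) == 0) &&
  [forall j : 'I_m, step (a j) (chain_at G l j) (chain_at G l j.+1)].

Lemma card_chain (n m : nat) (a : nat -> nat) (l : shape n) :
  paths m a l = #|[set G : {ffun 'I_m -> shape n} | chain a l G]|.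
Proof.
elim: m l => [|m IH] l /=.
  pose G0 : {ffun 'I_0 -> shape n} := [ffun=> [ffun=> ord0]].
  rewrite card_set_sum (big_pred1 G0) => [|G]; last by apply/esym/eqP/ffunP => -[].
  rewrite /chain (_ : [forall j : 'I_0, _]); last by apply/forallP => -[].
  by rewrite andbT /chain_at insubN.
rewrite card_set_sum sum_ffun_ordS [LHS]big_mkcond; apply: eq_bigr => k _.
have atE (G : {ffun 'I_m -> shape n}) j : j <= m ->
    chain_at (ffun_rcons G k) l j = chain_at G k j.
  move=> jm; case: (ltnP j m) => [lt_j|le_m].
    have := chain_at_lt (ffun_rcons G k) l (widen_ord (leqnSn m) (Ordinal lt_j)).
    rewrite ffun_rcons_widen /= => ->.
    by have := chain_at_lt G k (Ordinal lt_j) => /= ->.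
  have -> : j = m by apply/eqP; rewrite eqn_leq jm.
  by rewrite chain_at_last; have := chain_at_lt (ffun_rcons G k) l ord_max => /= ->; rewrite ffun_rcons_max.
have chE (G : {ffun 'I_m -> shape n}) : chain a l (ffun_rcons G k) = step (a m) k l && chain a k G.
  rewrite /chain atE // andbCA; congr (_ && _).
  apply/forallP/andP => [H|[sm /forallP H] j].
    split; first by have := H ord_max; rewrite /= atE // !chain_at_last.
    by apply/forallP => j; have := H (widen_ord (leqnSn m) j); rewrite /= !atE // ltnW.
  have := ltn_ord j; rewrite ltnS leq_eqVlt => /orP[/eqP ->|lt_j].
    by rewrite atE // !chain_at_last.
  by rewrite !atE ?(ltnW lt_j) //; apply: (H (Ordinal lt_j)).
under eq_bigr do rewrite chE.
case: ifP => _ /=; last by rewrite big1.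
by rewrite IH card_set_sum.
Qed.

Lemma card_ltn_ord (b x : nat) : x <= b -> #|[set y : 'I_b | y < x]| = x.
Proof.
move=> xb; rewrite -[RHS]card_ord -sum1_card (eq_bigl (fun y : 'I_b => y < x)).
  by rewrite -(big_ord_widen _ (fun _ => 1)) // sum1_card.
by move=> y; rewrite inE.
Qed.

(** A downward closed set is an initial segment, hence determined by its size. This is applied to
    the small entries of a row and to the stages of a chain that do not yet cover a given cell. *)
Lemma downward_closed_ord (b : nat) (p : pred 'I_b) (x : 'I_b) :
  (forall y z : 'I_b, y <= z -> p z -> p y) -> p x = (x < #|[set y | p y]|).
Proof.
move=> dc; apply/idP/idP => [px|].
  rewrite -[X in X <= _](card_ltn_ord (b := b)) //; apply/subset_leq_card/fintype.subsetP => y.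
  by rewrite !inE ltnS => yx; apply: dc px.
apply: contraTT => npx; rewrite -leqNgt.
rewrite -[X in _ <= X](card_ltn_ord (b := b)); last exact: ltnW.
apply/subset_leq_card/fintype.subsetP => y; rewrite !inE ltnNge => py; apply: contraNN npx => xy.
exact: dc py.
Qed.

Lemma card_row (la : seq nat) (i : 'I_(size la)) (Q : pred (cell la)) :
  #|[set d : cell la | (tag d == i) && Q d]| = #|[set x : 'I_(nth 0 la i) | Q (Tagged _ x)]|.
Proof.
have inj : injective (fun x : 'I_(nth 0 la i) => Tagged (fun i : 'I_(size la) => 'I_(nth 0 la i)) x).
  by move=> x y /eqP; rewrite eq_Tagged => /eqP.
rewrite -(card_imset _ inj); apply: eq_card => d; rewrite inE.
apply/andP/imsetP => [[/eqP ti Qd]|[x + ->]]; last by rewrite inE eqxx.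
case: d ti Qd => j x /= ji; move: x; rewrite ji => x Qd.
by exists x; rewrite ?inE.
Qed.

Lemma partn_size (n : nat) (la : seq nat) : is_partn n la -> size la <= n.
Proof.
case/and3P => _ la0 /eqP <-; rewrite sumnE -sum1_size.
elim: la la0 => [|x la IH]; first by rewrite !big_nil.
rewrite inE !big_cons negb_or => /andP[x0 /IH]; by move: x0; lia.
Qed.

Lemma partn_nth_le (n : nat) (la : seq nat) (i : nat) : is_partn n la -> nth 0 la i <= n.
Proof.
case/and3P => _ _ /eqP <-; elim: la i => [|x la IH] [|i] //=; first exact: leq_addr.
by apply: leq_trans (IH i) _; apply: leq_addl.
Qed.

Lemma partn_decr (n : nat) (la : seq nat) (i j : nat) :
  is_partn n la -> i <= j -> nth 0 la j <= nth 0 la i.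
Proof.
case/and3P => sla _ _ ij; case: (ltnP j (size la)) => [lt_j|le_j]; last by rewrite nth_default.
have geq_trans : transitive geq by move=> x y z /= h1 h2; apply: leq_trans h1.
have geq_refl : reflexive geq by move=> x /=.
apply: (sorted_leq_nth geq_trans geq_refl 0 sla) => //.
exact: leq_ltn_trans lt_j.
Qed.

Definition partn_shape (n : nat) (la : seq nat) : shape n := mk_shape n (nth 0 la).

Lemma partn_shapeE (n m : nat) (la : seq nat) (i : nat) :
  is_partn m la -> m <= n -> ffun_nat (partn_shape n la) i = nth 0 la i.
Proof.
move=> pla mn; case: (leqP i n) => [le_i|lt_i].
  by rewrite mk_shapeE // (leq_trans (partn_nth_le _ pla)).
rewrite ffun_nat_out // nth_default //.
by apply: leq_trans (partn_size pla) _; lia.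
Qed.

(** For semistandard [T], the length of row [i] of the shape filled by the entries below [j]. *)
Definition entries_lt (la : seq nat) (T : cell la -> nat) (j i : nat) : nat :=
  #|[set c : cell la | (tag c == i :> nat) && (T c < j)]|.

Lemma sum_entries_lt (n : nat) (la : seq nat) (T : cell la -> nat) (j : nat) :
  size la <= n.+1 -> \sum_(i < n.+1) entries_lt T j i = #|[set c : cell la | T c < j]|.
Proof.
move=> sla.
have lt_tag (c : cell la) : tag c < n.+1 by apply: leq_trans sla.
rewrite -[RHS]sum1_card (partition_big (fun c : cell la => Ordinal (lt_tag c)) xpredT) //=.
apply: eq_bigr => i _; rewrite /entries_lt -sum1_card; apply: eq_bigl => c.
by rewrite !inE -val_eqE andbC.
Qed.

Lemma entries_lt_out (la : seq nat) (T : cell la -> nat) (j i : nat) :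
  size la <= i -> entries_lt T j i = 0.
Proof.
move=> lei; apply/eqP; rewrite cards_eq0; apply/eqP/finset.setP => c; rewrite !inE.
by case: eqP => // ci; have := ltn_ord (tag c); rewrite ci ltnNge lei.
Qed.

Lemma entries_lt_row (la : seq nat) (T : cell la -> nat) (j : nat) (i : 'I_(size la)) :
  entries_lt T j i =
    #|[set x : 'I_(nth 0 la i) | T (Tagged (fun i : 'I_(size la) => 'I_(nth 0 la i)) x) < j]|.
Proof. exact: (card_row i (fun c => T c < j)). Qed.

Lemma entries_lt_le (la : seq nat) (T : cell la -> nat) (j i : nat) : entries_lt T j i <= nth 0 la i.
Proof.
case: (ltnP i (size la)) => [lt_i|le_i]; last by rewrite entries_lt_out.
rewrite (entries_lt_row T j (Ordinal lt_i)) (leq_trans (max_card _)) //.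
by rewrite card_ord.
Qed.

Lemma semistandardP (la : seq nat) (T : cell la -> nat) :
  reflect (forall c d : cell la,
     (tag c = tag d :> nat -> tagged c < tagged d -> T c <= T d) /\
     (tagged c = tagged d :> nat -> tag c < tag d -> T c < T d)) (semistandard T).
Proof.
apply: (iffP forallP) => [H c d|H c].
  have /forallP/(_ d)/andP[/implyP H1 /implyP H2] := H c.
  by split=> [/eqP e l|/eqP e l]; [apply: H1|apply: H2]; apply/andP.
apply/forallP => d; have [H1 H2] := H c d.
by apply/andP; split; apply/implyP => /andP[/eqP e l]; auto.
Qed.

Lemma entries_ltP (la : seq nat) (T : cell la -> nat) (j : nat) (c : cell la) :
  semistandard T -> (T c < j) = (tagged c < entries_lt T j (tag c)).
Proof.
move=> /semistandardP sst; case: c => i x /=; rewrite entries_lt_row.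
rewrite -(downward_closed_ord
  (p := fun y => T (Tagged (fun i : 'I_(size la) => 'I_(nth 0 la i)) y) < j)) // => y z.
rewrite leq_eqVlt => /orP[/eqP/val_inj -> //|yz].
apply: leq_ltn_trans.
exact: (proj1 (sst (Tagged (fun i : 'I_(size la) => 'I_(nth 0 la i)) y) (Tagged _ z))).
Qed.

(** Otherwise column [x] of row [i.+1] holds an entry at most [j], and column strictness puts an
    entry below [j] above it, in a column where row [i] has none left. This is the nontrivial half
    of the strip condition. *)
Lemma entries_lt_col (la : seq nat) (n : nat) (T : cell la -> nat) (j i : nat) :
  is_partn n la -> semistandard T -> entries_lt T j.+1 i.+1 <= entries_lt T j i.
Proof.
move=> pla sst; rewrite leqNgt; apply/negP => lt_x; set x := entries_lt T j i in lt_x.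
have lt_x1 : x < nth 0 la i.+1 by apply: leq_trans lt_x (entries_lt_le _ _ _).
have lt_i1 : i.+1 < size la by rewrite ltnNge; apply/negP => /(nth_default 0) E; rewrite E in lt_x1.
have lt_x0 : x < nth 0 la i by apply: leq_trans lt_x1 (partn_decr pla (leqnSn i)).
pose c1 : cell la := Tagged (fun i : 'I_(size la) => 'I_(nth 0 la i))
  (Ordinal lt_x1 : 'I_(nth 0 la (Ordinal lt_i1))).
pose c0 : cell la := Tagged (fun i : 'I_(size la) => 'I_(nth 0 la i))
  (Ordinal lt_x0 : 'I_(nth 0 la (Ordinal (ltnW lt_i1)))).
have T1 : T c1 < j.+1 by rewrite entries_ltP.
have /semistandardP/(_ c0 c1)[_ /(_ erefl (ltnSn i)) T01] := sst.
have : T c0 < j by apply: leq_trans T01 _; rewrite -ltnS.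
by rewrite entries_ltP //= ltnn.
Qed.

Section TableauxChains.
Variables (n m : nat) (a : nat -> nat) (la : seq nat).
Hypotheses (pla : is_partn n la).

Let l := partn_shape n la.

Let lE i : ffun_nat l i = nth 0 la i.
Proof. exact: partn_shapeE pla (leqnn n). Qed.

Let to_chain (T : {ffun cell la -> 'I_m.+1}) : {ffun 'I_m.+1 -> shape n} :=
  [ffun j : 'I_m.+1 => mk_shape n (entries_lt (fun c => T c : nat) j)].

(** Counting the stages that miss the cell gives the index of the strip that covers it. *)
Let of_chain (G : {ffun 'I_m.+1 -> shape n}) : {ffun cell la -> 'I_m.+1} :=
  [ffun c : cell la => inord #|[set j : 'I_m.+1 | ffun_nat (chain_at G l j.+1) (tag c) <= tagged c]|].

Let to_chainE T j i : j <= m.+1 ->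
  ffun_nat (chain_at (to_chain T) l j) i = entries_lt (fun c => T c : nat) j i.
Proof.
rewrite leq_eqVlt => /orP[/eqP ->|lt_j].
  rewrite chain_at_last lE; case: (ltnP i (size la)) => [lt_i|le_i]; last first.
    by rewrite nth_default // entries_lt_out.
  rewrite (entries_lt_row _ _ (Ordinal lt_i)) -[LHS]card_ord -cardsT.
  by apply: eq_card => x; rewrite !inE ltn_ord.
have -> := chain_at_lt (to_chain T) l (Ordinal lt_j); rewrite ffunE /=.
case: (leqP i n) => [le_i|lt_i].
  by rewrite mk_shapeE // (leq_trans (entries_lt_le _ _ _)) // (partn_nth_le _ pla).
by rewrite ffun_nat_out // entries_lt_out // (leq_trans (partn_size pla)) // ltnW.
Qed.

Let content_step (T : cell la -> nat) j :
  #|[set c | T c < j.+1]| = #|[set c | T c < j]| + #|[set c | T c == j]|.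
Proof.
rewrite -cardsUI [X in _ = _ + X](_ : _ = 0) ?addn0; last first.
  by apply/eqP; rewrite cards_eq0; apply/eqP/finset.setP => c; rewrite !inE; case: ltngtP.
by apply: eq_card => c; rewrite !inE ltnS leq_eqVlt orbC.
Qed.

Let size_la : size la <= n.+1.
Proof. by apply: leqW; apply: partn_size pla. Qed.

Let chain_incr (G : {ffun 'I_m.+1 -> shape n}) (i : nat) : chain a l G -> forall j k : nat, j <= k -> k <= m.+1 ->
  ffun_nat (chain_at G l j) i <= ffun_nat (chain_at G l k) i.
Proof.
move=> /andP[_ /forallP ch] j; elim=> [|k IH]; first by rewrite leqn0 => /eqP ->.
rewrite leq_eqVlt => /orP[/eqP -> //|jk] km.
have /andP[/stripP st _] := ch (Ordinal km).
by apply: leq_trans (IH jk (ltnW km)) _; case/andP: (st i).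
Qed.

Let chain_decr (G : {ffun 'I_m.+1 -> shape n}) (j : nat) : chain a l G -> 0 < j <= m.+1 -> forall i k : nat, i <= k ->
  ffun_nat (chain_at G l j) k <= ffun_nat (chain_at G l j) i.
Proof.
case: j => // j /andP[_ /forallP ch] /= jm i; elim=> [|k IH]; first by rewrite leqn0 => /eqP ->.
rewrite leq_eqVlt => /orP[/eqP -> //|ik].
have /andP[/stripP st _] := ch (Ordinal jm).
by apply: leq_trans (IH ik); have /andP[h1 h2] := st k; apply: leq_trans h2.
Qed.

Let chain0 (G : {ffun 'I_m.+1 -> shape n}) i : chain a l G -> ffun_nat (chain_at G l 0) i = 0.
Proof.
case/andP; rewrite weight0 => /eqP -> _.
by rewrite /ffun_nat; case: insub => //= ?; rewrite ffunE.
Qed.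

Let of_chainE (G : {ffun 'I_m.+1 -> shape n}) : chain a l G -> forall (c : cell la) j, j <= m.+1 ->
  (of_chain G c < j) = (tagged c < ffun_nat (chain_at G l j) (tag c)).
Proof.
move=> ch c.
set p : pred 'I_m.+1 := fun j : 'I_m.+1 => ffun_nat (chain_at G l j.+1) (tag c) <= tagged c.
have dc (y z : 'I_m.+1) : y <= z -> p z -> p y.
  by move=> yz; apply: leq_trans; apply: chain_incr.
(* The final shape [l] contains every cell, so [inord] in [of_chain] does not truncate. *)
have lt_p : #|[set j | p j]| < m.+1.
  have pm := downward_closed_ord ord_max dc.
  have : ~~ p ord_max by rewrite /p /= chain_at_last lE -ltnNge.
  by rewrite pm -leqNgt.
have val_c : of_chain G c = #|[set j | p j]| :> nat by rewrite ffunE inordK.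
case=> [|j] jm; first by rewrite chain0.
have := downward_closed_ord (Ordinal jm) dc; rewrite -val_c /= => pj.
by rewrite [RHS]ltnNge -/(p (Ordinal jm)) pj -leqNgt ltnS.
Qed.

(** A tableau corresponds to the chain of shapes filled by its entries below [j], and its content to
    the sizes of the strips. The alphabet has the form [m.+1] because [of_chain] uses [inord]. *)
Lemma card_tableaux_paths :
  #|[set T : {ffun cell la -> 'I_m.+1} |
      semistandard (fun c => T c) &&
      [forall i : 'I_m.+1, #|[set c | T c == i]| == a i]]| = paths m.+1 a l.
Proof.
rewrite card_chain; apply: (card_bij (f := to_chain) (g := of_chain)) => [T|G]; rewrite !inE.
  case/andP => sst /forallP cnt.
  have wE k : k <= m.+1 -> weight (chain_at (to_chain T) l k) = #|[set c | (T c : nat) < k]|.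
    move=> km; rewrite -(sum_entries_lt (n := n)) //; apply: eq_bigr => i _.
    by rewrite to_chainE.
  have ch : chain a l (to_chain T).
    apply/andP; split.
      by rewrite wE // cards_eq0; apply/eqP/finset.setP => c; rewrite !inE.
    apply/forallP => j; apply/andP; split.
      apply/stripP => i; rewrite !to_chainE ?(ltnW (ltn_ord j)) //.
      rewrite (entries_lt_col _ _ pla sst) /=.
      apply/subset_leq_card/fintype.subsetP => c; rewrite !inE => /andP[-> /=]; exact: ltnW.
    by rewrite !wE ?(ltnW (ltn_ord j)) // content_step (eqP (cnt j)).
  split=> //; apply/ffunP => c; apply: val_inj => /=.
  have lt_iff k : k <= m.+1 -> (of_chain (to_chain T) c < k) = (T c < k).
    by move=> km; rewrite (of_chainE ch) // to_chainE // -(entries_ltP _ _ sst).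
  apply/eqP; rewrite eqn_leq; apply/andP; split; rewrite -ltnS.
    by rewrite lt_iff ?ltnSn.
  by rewrite -lt_iff ?ltnSn.
move=> ch.
have sst : semistandard (fun c => of_chain G c : nat).
  apply/semistandardP => c d; split=> [tcd lt_cd|tcd lt_cd].
    rewrite -ltnS (of_chainE ch) // (congr1 (ffun_nat _) tcd); apply: ltn_trans lt_cd _.
    by rewrite -(of_chainE ch) // ltnSn.
  have jm := ltn_ord (of_chain G d).
  rewrite (of_chainE ch) // ?(ltnW jm) // tcd.
  have := ltnSn (of_chain G d); rewrite (of_chainE ch) // => /leq_trans; apply.
  have /andP[_ /forallP/(_ (of_chain G d))/andP[/stripP st _]] := ch.
  apply: leq_trans (chain_decr ch _ lt_cd) _ => //.
  by case/andP: (st (tag c)).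
have eG j i : j <= m.+1 -> entries_lt (fun c => of_chain G c : nat) j i = ffun_nat (chain_at G l j) i.
  move=> jm; have le_la : ffun_nat (chain_at G l j) i <= nth 0 la i.
    by have := chain_incr i ch jm (leqnn _); rewrite chain_at_last lE.
  case: (ltnP i (size la)) => [lt_i|le_i]; last first.
    by rewrite entries_lt_out //; move: le_la; rewrite nth_default // leqn0 => /eqP.
  rewrite (entries_lt_row _ _ (Ordinal lt_i)) -[RHS](card_ltn_ord le_la).
  by apply: eq_card => x; rewrite !inE (of_chainE ch).
split.
  rewrite sst /=; apply/forallP => j; apply/eqP.
  have /andP[_ /forallP/(_ j)/andP[_ /eqP]] := ch.
  have wE k : k <= m.+1 -> weight (chain_at G l k) = #|[set c | (of_chain G c : nat) < k]|.
    move=> km; rewrite -(sum_entries_lt (n := n)) //; apply: eq_bigr => i _.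
    by rewrite eG.
  by rewrite !wE ?(ltnW (ltn_ord j)) // content_step => /addnI.
apply/ffunP => j; apply: ffun_nat_inj => i _.
have := to_chainE (of_chain G) i (ltnW (ltn_ord j)); rewrite eG ?(ltnW (ltn_ord j)) //.
by rewrite !chain_at_lt.
Qed.

End TableauxChains.

Lemma sumn_take (s : seq nat) (k : nat) : sumn (take k s) = \sum_(j < k) nth 0 s j.
Proof.
elim: k s => [|k IH] [|x s] /=; rewrite ?big_ord0 //.
  by rewrite big1 // => j _; rewrite nth_nil.
by rewrite big_ord_recl IH.
Qed.

Lemma card_lt_sum (T : finType) (f : T -> nat) (k : nat) :
  #|[set c | f c < k]| = \sum_(j < k) #|[set c | f c == j]|.
Proof.
elim: k => [|k IH].
  by rewrite big_ord0; apply/eqP; rewrite cards_eq0; apply/eqP/finset.setP => c; rewrite !inE.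
rewrite big_ord_recr -IH /= -cardsUI [X in _ = _ + X](_ : _ = 0) ?addn0; last first.
  by apply/eqP; rewrite cards_eq0; apply/eqP/finset.setP => c; rewrite !inE; case: ltngtP.
by apply: eq_card => c; rewrite !inE ltnS leq_eqVlt orbC.
Qed.

(** Columns increase strictly, so the entries below [j] all lie in the first [j] rows. *)
Lemma Kostka_dominated (n : nat) (la mu : seq nat) :
  is_partn n la -> Kostka la mu != 0 -> dominated mu la.
Proof.
move=> pla; rewrite -lt0n card_gt0 => /set0Pn[T]; rewrite inE => /andP[sst /forallP cnt] j.
(* [entries_lt_col] moves one row up and lowers the bound by one; at bound 0 no entry is left. *)
have low d i : entries_lt (fun c => T c : nat) i (i + d) = 0.
  apply/eqP; rewrite -leqn0; elim: i => [|i IH]; last first.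
    by apply: leq_trans IH; apply: entries_lt_col pla sst.
  by rewrite leqn0 cards_eq0; apply/eqP/finset.setP => c; rewrite !inE andbF.
have -> : sumn (take j mu) = #|[set c | (T c : nat) < j]|.
  rewrite sumn_take card_lt_sum; apply: eq_bigr => i _.
  case: (ltnP i (size mu)) => [lt_i|le_i]; first by rewrite -(eqP (cnt (Ordinal lt_i))).
  rewrite nth_default //; apply/esym/eqP; rewrite cards_eq0; apply/eqP/finset.setP => c.
  by rewrite !inE ltn_eqF // (leq_trans (ltn_ord _)).
(* The range [n + j] covers all rows of [la] and splits off the first [j] of them. *)
rewrite -(@sum_entries_lt (n + j)); last first.
  by apply: leq_trans (partn_size pla) _; rewrite -addSn ltnW ?leq_addr // ltnS leq_addr.
rewrite sumn_take -addSn addnC big_split_ord /= [X in _ + X]big1 ?addn0 => [|i _]; last exact: low.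
by apply: leq_sum => i _; apply: entries_lt_le.
Qed.

Lemma Kostka_diag (la : seq nat) : 0 < Kostka la la.
Proof.
rewrite card_gt0; apply/set0Pn; exists [ffun c : cell la => tag c]; rewrite inE.
apply/andP; split.
  by apply/semistandardP => c d; rewrite !ffunE; split=> // tcd _; rewrite leq_eqVlt tcd eqxx.
apply/forallP => i; apply/eqP; rewrite -[RHS]card_ord -cardsT.
rewrite -(card_row i predT); apply: eq_card => c; by rewrite !inE ffunE andbT.
Qed.

(** * Orders on the fibers of a map *)

Lemma preim_pblock (n : nat) (X : eqType) (f : 'I_n -> X) (i j : 'I_n) :
  (j \in finset.pblock (finset.preim_partition f [set: 'I_n]%SET) i) = (f i == f j).
Proof.
by rewrite pblock_equivalence_partition ?inE // => x y z _ _ _ /=; split=> // /eqP ->.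
Qed.

Definition fiber_order (n : nat) (X : eqType) (f : 'I_n -> X) (L : {set 'I_n * 'I_n}) : Prop :=
  [/\ forall i j, (i, j) \in L -> f i = f j,
      forall i j, (i, j) \in L -> (j, i) \in L -> i = j,
      forall i j k, (i, j) \in L -> (j, k) \in L -> (i, k) \in L
    & forall i j, f i = f j -> ((i, j) \in L) || ((j, i) \in L)].

Lemma block_ordersP (n : nat) (X : eqType) (f : 'I_n -> X) (L : {set 'I_n * 'I_n}) :
  block_orders (finset.preim_partition f [set: 'I_n]%SET) L <-> fiber_order f L.
Proof.
set P := finset.preim_partition f _.
have bP i j : (j \in finset.pblock P i) = (f i == f j) by exact: preim_pblock.
have PP : finset.partition P [set: 'I_n]%SET by exact: preim_partitionP.
have [covP trP _] := and3P PP.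
have inP i : finset.pblock P i \in P by rewrite pblock_mem // (eqP covP) inE.
have inB (B : {set 'I_n}) i j : B \in P -> i \in B -> (j \in B) = (f i == f j).
  by move=> BP iB; rewrite -bP (def_pblock trP BP iB).
split=> [[L1 L2]|[L1 L2 L3 L4]].
  have L1' i j : (i, j) \in L -> f i = f j by move/L1; rewrite bP => /eqP.
  split=> // [i j ij ji|i j k ij jk|i j fij].
  - have [anti _ _] := L2 _ (inP i).
    apply: anti; rewrite ?bP ?(L1' _ _ ij) ?eqxx //; by rewrite ij ji.
  - have [_ tr _] := L2 _ (inP i).
    apply: (tr j i k) => //; rewrite ?bP ?eqxx ?(L1' _ _ ij) ?(L1' _ _ jk) ?eqxx //.
  - have [_ _ to] := L2 _ (inP i).
    by apply: to; rewrite ?bP ?fij ?eqxx.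
split=> [i j /L1 fij|B BP]; first by rewrite bP fij.
split=> [x y xB yB /andP[]|y x z yB xB zB|x y xB yB]; [exact: L2|exact: L3|].
by apply: L4; apply/eqP; rewrite -(inB B x y).
Qed.

(** This is what makes the coefficient of [h_nc (ker g)] at a word [w] a count of orders on the
    fibers of the pair of [w] and [g]. *)
Lemma partition_meet_preim (n : nat) (X Y : eqType) (f : 'I_n -> X) (g : 'I_n -> Y) :
  partition_meet (finset.preim_partition f [set: 'I_n]%SET)
                 (finset.preim_partition g [set: 'I_n]%SET) =
  finset.preim_partition (fun i => (f i, g i)) [set: 'I_n]%SET.
Proof.
have mem (Z : eqType) (h : 'I_n -> Z) (B : {set 'I_n}) :
    (B \in finset.preim_partition h [set: 'I_n]%SET) = [exists i, B == [set j | h i == h j]%SET].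
  apply/imsetP/existsP => [[i _ ->]|[i /eqP ->]]; exists i => //.
    by apply/eqP/setP => j; rewrite !inE.
  by apply/setP => j; rewrite !inE.
apply/setP => B; rewrite mem !inE; apply/andP/existsP => [[B0 /imset2P[C D]]|[i /eqP ->]].
  rewrite !mem => /existsP[i /eqP ->] /existsP[j /eqP ->] BE.
  have /set0Pn[k] := B0; rewrite BE !inE => /andP[/eqP fk /eqP gk].
  by exists k; apply/eqP/setP => u; rewrite !inE xpair_eqE fk gk.
split; first by apply/set0Pn; exists i; rewrite inE.
apply/imset2P; exists [set j | f i == f j]%SET [set j | g i == g j]%SET.
- by rewrite mem; apply/existsP; exists i.
- by rewrite mem; apply/existsP; exists i.
- by apply/setP => j; rewrite !inE xpair_eqE.
Qed.

Section CountFiberOrders.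
Variables (n : nat) (X : eqType) (f : 'I_n -> X).

Let rank (L : {set 'I_n * 'I_n}) (i : 'I_n) : nat := #|[set j | (j, i) \in L]%SET|.

Let rank_ltP L : fiber_order f L -> forall i j, f i = f j -> (rank L i <= rank L j) = ((i, j) \in L).
Proof.
case=> L1 L2 L3 L4 i j fij; apply/idP/idP; last first.
  by move=> ij; apply/subset_leq_card/fintype.subsetP => k; rewrite !inE => ki; apply: L3 ij.
apply: contraTT => nij; rewrite -ltnNge.
have ji : (j, i) \in L by have := L4 _ _ fij; rewrite (negPf nij).
apply/proper_card/properP; split.
  by apply/fintype.subsetP => k; rewrite !inE => kj; apply: L3 ji.
exists i; rewrite inE //.
by have := L4 _ _ (erefl (f i)); rewrite orbb.
Qed.

(* The ranks within a fiber of size [p] are exactly [1, ..., p]. *)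
Let fiber_rank L : fiber_order f L -> forall x k,
  fiber_card (fun i => (f i, rank L i)) (x, k) = (0 < k <= fiber_card f x).
Proof.
move=> oL x k; have [L1 L2 L3 L4] := oL.
have r_in i : 0 < rank L i <= fiber_card f (f i).
  apply/andP; split.
    by rewrite card_gt0; apply/set0Pn; exists i; rewrite inE; have := L4 _ _ (erefl (f i)); rewrite orbb.
  by apply/subset_leq_card/fintype.subsetP => j; rewrite !inE => /L1 ->.
have r_inj : {in [set i | f i == x]%SET &, injective (rank L)}.
  move=> i j; rewrite !inE => /eqP fi /eqP fj rij.
  by apply: L2; rewrite -(rank_ltP oL) ?fi ?fj // rij.
pose r i : 'I_n.+1 := inord (rank L i).
have rE i : r i = rank L i :> nat by rewrite inordK // ltnS (leq_trans (max_card _)) ?card_ord.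
have fx_le : fiber_card f x <= n by rewrite (leq_trans (max_card _)) ?card_ord.
have /eqP imE : [set r i | i in [set i | f i == x]%SET]%SET ==
    [set k : 'I_n.+1 | 0 < k <= fiber_card f x]%SET.
  rewrite eqEcard; apply/andP; split.
    apply/fintype.subsetP => _ /imsetP[i + ->]; rewrite !inE rE => /eqP <-; exact: r_in.
  rewrite card_in_imset; last by move=> i j ii jj /(congr1 val) /=; rewrite !rE; apply: r_inj.
  rewrite [X in _ <= X](_ : _ = fiber_card f x) //.
  have -> : [set k : 'I_n.+1 | 0 < k <= fiber_card f x]%SET =
      [set lift ord0 (widen_ord fx_le y) | y in 'I_(fiber_card f x)]%SET.
    apply/setP => y; rewrite inE; apply/andP/imsetP => [[y0 yx]|[z _ ->]]; last by rewrite /= /bump /= ltn_ord.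
    have lt_y : y.-1 < fiber_card f x by rewrite prednK.
    by exists (Ordinal lt_y) => //; apply: val_inj; rewrite /= /bump /= add1n prednK.
  by rewrite (leq_trans (leq_imset_card _ _)) ?card_ord.
case: (boolP (0 < k <= _)) => kx.
  have lt_k : k < n.+1 by rewrite ltnS (leq_trans _ fx_le) //; case/andP: kx.
  have : Ordinal lt_k \in [set r i | i in [set i | f i == x]%SET]%SET by rewrite imE inE.
  case/imsetP => i ix /(congr1 val) /=; rewrite rE => ki.
  rewrite /fiber_card -[RHS](cards1 i); apply: eq_card => j; rewrite !inE xpair_eqE.
  apply/andP/eqP => [[fj /eqP rj]|->]; last by rewrite -ki eqxx; move: ix; rewrite inE.
  by apply: r_inj => //; rewrite ?inE // rj.
apply/eqP; rewrite cards_eq0; apply/eqP/setP => i; rewrite !inE xpair_eqE.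
apply/negP => /andP[/eqP fi /eqP ri]; move: kx; by rewrite -ri -fi r_in.
Qed.

(* Pulling the standard order of each fiber back along the permutations that
   preserve [f] gives each family of orders exactly once. *)
Lemma card_fiber_orders :
  #|[set L : {set 'I_n * 'I_n} | `[< fiber_order f L >]]%SET| = #|stab f|.
Proof.
pose pull (s : {perm 'I_n}) : {set 'I_n * 'I_n} :=
  [set p | (f p.1 == f p.2) && (s p.1 <= s p.2)]%SET.
have pullE s i j : ((i, j) \in pull s) = (f i == f j) && (s i <= s j) by rewrite inE.
have oP s : fiber_order f (pull s).
  split=> [i j|i j|i j k|i j fij]; rewrite !pullE.
  - by case/andP => /eqP.
  - move=> /andP[_ h1] /andP[_ h2]; apply: (@perm_inj _ s); apply: val_inj => /=; lia.
  - by move=> /andP[/eqP -> h1] /andP[-> h2]; apply: leq_trans h2.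
  - by rewrite fij eqxx /= leq_total.
rewrite -(card_in_imset (f := pull) (D := mem (stab f))).
  apply: eq_card => L; rewrite inE; apply/asboolP/imsetP => [oL|[s _ ->] //].
  (* By [fiber_rank] the joint fiber sizes of [f] and the rank are the same for all orders, so a
     permutation carries the standard ranks to those of [L]. *)
  have /perm_of_fibers[s sE] p : fiber_card (fun i => (f i, rank (pull 1%g) i)) p =
      fiber_card (fun i => (f i, rank L i)) p.
    by case: p => x k; rewrite !fiber_rank.
  have sf i : f (s i) = f i by have [<-] := sE i.
  have sr i : rank L i = rank (pull 1%g) (s i) by have [_ ->] := sE i.
  exists s; first by apply/stabP.
  apply/setP => -[i j]; rewrite pullE; apply/idP/andP => [ij|[/eqP fij sij]].
    have fij : f i = f j by case: oL ij => L1 _ _ _ /L1.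
    rewrite fij; split=> //; move: ij; rewrite -(rank_ltP oL) // !sr.
    by rewrite (rank_ltP (oP 1%g)) ?sf // pullE !perm1 => /andP[].
  by rewrite -(rank_ltP oL) // !sr (rank_ltP (oP 1%g)) ?sf // pullE !perm1 !sf fij eqxx.
move=> s t /stabP sf /stabP tf pst; apply/permP => i.
(* Since the rank in a pulled back order is the standard rank of the image, the order [pull u]
   determines [u]. *)
have rk (u : {perm 'I_n}) : (forall i, f (u i) = f i) -> rank (pull u) i = rank (pull 1%g) (u i).
  move=> uf; rewrite /rank -(card_imset _ (@perm_inj _ u)); apply: eq_card => j.
  rewrite inE pullE !perm1; apply/imsetP/andP => [[k + ->]|[fj ju]].
    by rewrite inE pullE !uf => /andP[].
  have fuj : f (u^-1%g j) = f j by rewrite -[LHS]uf permKV.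
  by exists (u^-1%g j); rewrite ?permKV // inE pullE permKV fuj (eqP fj) uf eqxx.
have := rk t tf; rewrite -pst rk // => rst.
have [L1 L2 L3 L4] := oP 1%g.
by apply: L2; rewrite -(rank_ltP (oP 1%g)) ?sf ?tf // rst.
Qed.

End CountFiberOrders.

(** * Words and their content types *)

Definition content_type (w : seq nat) : seq nat := sort geq [seq count_mem i w | i <- undup w].

Definition letter (n : nat) (w : seq nat) (i : 'I_n) : nat := nth 0 w i.

Definition word (n : nat) (f : 'I_n -> nat) : seq nat := [seq f i | i <- enum 'I_n].

Lemma size_word n (f : 'I_n -> nat) : size (word f) = n.
Proof. by rewrite size_map size_enum_ord. Qed.

Lemma letter_word n (f : 'I_n -> nat) i : letter (word f) i = f i.
Proof. by rewrite /letter (nth_map i) ?size_enum_ord // nth_ord_enum. Qed.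

Lemma word_letter n w : size w = n -> word (@letter n w) = w.
Proof.
move=> sw; apply: (@eq_from_nth _ 0) => [|i]; rewrite size_word ?sw // => lt_i.
by rewrite -[LHS]/(letter (word (@letter n w)) (Ordinal lt_i)) letter_word.
Qed.

Lemma eq_word n (f g : 'I_n -> nat) : f =1 g -> word f = word g.
Proof. by move=> fg; apply: eq_map. Qed.

Lemma fiber_card_letter n w x : size w = n -> fiber_card (@letter n w) x = count_mem x w.
Proof. by move=> sw; rewrite fiber_cardE -/(word _) word_letter. Qed.

Lemma geq_total : total geq. Proof. by move=> x y; apply: leq_total. Qed.
Lemma geq_trans : transitive geq. Proof. by move=> x y z /= h1 h2; apply: leq_trans h1. Qed.
Lemma geq_anti : antisymmetric geq. Proof. by move=> x y /andP[h1 h2]; apply: anti_leq; apply/andP; split. Qed.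

Lemma sort_geq_perm (s t : seq nat) : perm_eq s t -> sort geq s = sort geq t.
Proof. by move/(perm_sortP geq_total geq_trans geq_anti). Qed.

Lemma content_type_map (p : nat -> nat) w : injective p -> content_type [seq p i | i <- w] = content_type w.
Proof.
move=> pI; rewrite /content_type undup_map_inj // -map_comp; congr sort.
by apply: eq_map => i /=; rewrite count_map; apply: eq_count => j /=; rewrite inj_eq.
Qed.

Lemma content_type_perm w v : perm_eq w v -> content_type w = content_type v.
Proof.
move=> wv; apply: sort_geq_perm.
rewrite (eq_map (fun i => seq.permP wv (pred1 i))); apply/perm_map/uniq_perm; rewrite ?undup_uniq //.
by move=> i; rewrite !mem_undup (perm_mem wv).
Qed.

Lemma sum_count_undup (w : seq nat) : sumn [seq count_mem i w | i <- undup w] = size w.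
Proof.
have H (u : seq nat) : uniq u -> sumn [seq count_mem i w | i <- u] = count (mem u) w.
  elim: u => [_|x u IH /= /andP[xu /IH ->]]; first by rewrite count_pred0.
  rewrite -count_predUI [X in _ + X = _](_ : _ = 0) ?addn0.
    by apply: eq_count => i; rewrite /= inE.
  apply/eqP; rewrite -leqn0 leqNgt -has_count; apply/hasPn => i _ /=.
  by apply/negP => /andP[/eqP ->]; apply/negP.
rewrite H ?undup_uniq // -[RHS]count_predT; apply: eq_in_count => i iw /=.
by rewrite mem_undup iw.
Qed.

Lemma content_type_partn w n : size w = n -> is_partn n (content_type w).
Proof.
move=> sw; apply/and3P; split; first exact: (sort_sorted geq_total).
  rewrite mem_sort; apply/mapP => -[i]; rewrite mem_undup => iw /esym/eqP.
  by rewrite -leqn0 leqNgt -has_count has_pred1 iw.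
by rewrite (perm_sumn (permEl (perm_sort geq _))) sum_count_undup sw.
Qed.

Lemma partn_ext (n m : nat) la mu : is_partn n la -> is_partn m mu ->
  (forall i, nth 0 la i = nth 0 mu i) -> la = mu.
Proof.
have half k l s t : is_partn k s -> is_partn l t -> (forall i, nth 0 s i = nth 0 t i) -> size s <= size t.
  move=> /and3P[_ s0 _] _ st; rewrite leqNgt; apply/negP => lt_t.
  by case/negP: s0; rewrite -(nth_default 0 (leqnn (size t))) -st mem_nth.
move=> pla pmu E; apply: (@eq_from_nth _ 0) => [|i _]; last exact: E.
apply/eqP; rewrite eqn_leq (half n m) // (half m n) // => i; by rewrite E.
Qed.

Lemma content_type_eq n w nu : is_partn n nu -> (forall i, count_mem i w = nth 0 nu i) ->
  content_type w = nu.
Proof.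
case/and3P => snu nu0 _ wnu.
rewrite /content_type -[RHS](sorted_sort geq_trans snu); apply: sort_geq_perm.
rewrite (eq_map wnu) -[X in perm_eq _ X](mkseq_nth 0 nu); apply/perm_map/uniq_perm.
- exact: undup_uniq.
- exact: iota_uniq.
move=> i; rewrite mem_undup mem_iota add0n /= -has_pred1 has_count wnu.
case: (ltnP i (size nu)) => [lt_i|le_i]; last by rewrite nth_default.
by rewrite lt0n; apply: contraNN nu0 => /eqP <-; apply: mem_nth.
Qed.

Lemma exists_content_map n la : is_partn n la ->
  exists f : {ffun 'I_n -> 'I_(size la)}, forall i, fiber_card f i = nth 0 la i.
Proof.
case/and3P => _ _ /eqP sla.
have [|f fE] := @exists_fibers 'I_(size la) (fun i => nth 0 la i) n.
  by rewrite -sumn_take take_size.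
by exists [ffun i => f i] => i; rewrite -fE; apply: eq_fiber_card => j; rewrite ffunE.
Qed.

Lemma count_word_ord n k (f : 'I_n -> 'I_k) (a : nat -> nat) :
  (forall i, fiber_card f i = a (i : 'I_k)) -> (forall i, k <= i -> a i = 0) ->
  forall i, count_mem i (word (fun j => f j : nat)) = a i.
Proof.
move=> fa a0 i; rewrite /word -fiber_cardE; case: (ltnP i k) => [lt_i|le_i].
  rewrite -[RHS](fa (Ordinal lt_i)) !fiber_card_sum; apply: eq_bigl => j.
  by rewrite -val_eqE.
rewrite a0 // fiber_card_sum big1 // => j /eqP fj.
by have := ltn_ord (f j); rewrite fj ltnNge le_i.
Qed.

Lemma card_stab_letter n w : size w = n -> #|stab (@letter n w)| = partn_fact (content_type w).
Proof.
move=> sw; rewrite (card_stab (xs := undup w)) ?undup_uniq // => [|i]; last first.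
  by rewrite mem_undup mem_nth // sw.
rewrite /partn_fact (perm_big _ (permEl (perm_sort geq _))) big_map.
by apply: eq_bigr => x _; rewrite fiber_card_letter.
Qed.

(** Orbit-stabilizer for all permutations acting on maps, the orbit of [g0] being given by
    [perm_of_fibers]. *)
Lemma card_fiber_class n (Y : finType) (g0 : 'I_n -> Y) :
  #|[set g : {ffun 'I_n -> Y} | [forall y, fiber_card g y == fiber_card g0 y]]| * #|stab g0| = n`!.
Proof.
have -> : n`! = \sum_(s : 'S_n) 1 by rewrite sum1_card card_Sn.
set C := [set g | _]; rewrite (partition_big (fun s : 'S_n => [ffun i => g0 (s i)]) (mem C)) /=.
  rewrite -sum_nat_const; apply: eq_bigr => g; rewrite inE => /forallP gg0.
  have /perm_of_fibers[t tE] y : fiber_card g0 y = fiber_card g y by rewrite (eqP (gg0 y)).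
  rewrite -(card_stab_transport tE) sum1_card; apply: eq_card => s.
  rewrite inE -[RHS]/([ffun i => g0 (s i)] == g).
  apply/forallP/eqP => [H|<- i]; last by rewrite ffunE.
  by apply/ffunP => i; rewrite ffunE (eqP (H i)).
move=> s _; rewrite inE; apply/forallP => y; apply/eqP.
by apply: (fiber_card_perm (s := s)) => i; rewrite ffunE.
Qed.

(** * Partitions as shapes, and Kostka numbers as chain counts *)

Definition shape_partn (n : nat) (l : shape n) : seq nat :=
  [seq x <- mkseq (ffun_nat l) n.+1 | x != 0].

Lemma nth_filter_nonzero (s : seq nat) (i : nat) :
  sorted geq s -> nth 0 [seq x <- s | x != 0] i = nth 0 s i.
Proof.
elim: s i => [//|x s IH] i /= sx; case: eqP => [x0|_] /=; last first.
  by case: i => [//|i] /=; apply/IH/path_sorted/sx.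
have /allP s0 : all (geq x) s by apply: order_path_min sx; exact: geq_trans.
have z y : y \in s -> y = 0 by move=> /s0 /=; rewrite x0 leqn0 => /eqP.
rewrite (_ : [seq _ <- s | _] = [::]) ?nth_nil; last first.
  apply/eqP; rewrite -[_ == _]negbK -has_filter; apply/hasPn => y /z ->; by rewrite eqxx.
case: i => [//|i] /=; case: (ltnP i (size s)) => [lt_i|le_i]; last by rewrite nth_default.
by rewrite (z (nth 0 s i)) // mem_nth.
Qed.

Lemma sorted_mkseq_shape (n : nat) (l : shape n) : strip l l -> sorted geq (mkseq (ffun_nat l) n.+1).
Proof.
move=> /stripP ll; apply: (homo_sorted (e := ltn)); last exact: iota_ltn_sorted.
move=> i j; elim: j => //= j IH; rewrite ltnS leq_eqVlt => /orP[/eqP ->|/IH H].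
  by case/andP: (ll j).
by apply: leq_trans H; case/andP: (ll j).
Qed.

Lemma nth_shape_partn (n : nat) (l : shape n) i : strip l l -> nth 0 (shape_partn l) i = ffun_nat l i.
Proof.
move=> ll; rewrite nth_filter_nonzero ?sorted_mkseq_shape //.
case: (ltnP i n.+1) => [lt_i|le_i]; first by rewrite nth_mkseq.
by rewrite nth_default ?size_mkseq // ffun_nat_out.
Qed.

Lemma shape_partnP (n : nat) (l : shape n) : strip l l -> is_partn (weight l) (shape_partn l).
Proof.
move=> ll; apply/and3P; split.
- exact: (sorted_filter geq_trans) (sorted_mkseq_shape ll).
- by rewrite mem_filter.
rewrite /shape_partn /mkseq sumnE big_filter big_map -[iota 0 n.+1]/(index_iota 0 n.+1) big_mkord.
rewrite big_mkcond /weight; apply/eqP/eq_bigr => i _.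
by case: eqP => [->|].
Qed.

Lemma shape_partnK (n : nat) (l : shape n) : strip l l -> weight l = n ->
  partn_shape n (shape_partn l) = l.
Proof.
move=> ll wl; have := shape_partnP ll; rewrite wl => pl.
by apply: ffun_nat_inj => i _; rewrite (partn_shapeE _ pl) // nth_shape_partn.
Qed.

Lemma partn_shape_strip (n : nat) la : is_partn n la ->
  strip (partn_shape n la) (partn_shape n la) /\ weight (partn_shape n la) = n.
Proof.
move=> pla; split.
  apply/stripP => i; rewrite !(partn_shapeE _ pla) // leqnn andbT.
  exact: partn_decr pla (leqnSn i).
have /and3P[_ _ /eqP sla] := pla; rewrite -[RHS]sla.
rewrite -[la in RHS](@take_oversize _ n.+1) ?sumn_take; last by rewrite leqW // (partn_size pla).
by apply: eq_bigr => i _; rewrite (partn_shapeE _ pla).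
Qed.

Lemma partn_shapeK (n : nat) la : is_partn n la -> shape_partn (partn_shape n la) = la.
Proof.
move=> pla; have [ll wl] := partn_shape_strip pla.
apply: (partn_ext (shape_partnP ll) pla) => i.
by rewrite nth_shape_partn // (partn_shapeE _ pla).
Qed.

(** Partitions are sequences, which form no finite type; listing them through shapes makes the sums
    over them finite. *)
Definition partns (n : nat) : seq (seq nat) :=
  [seq shape_partn l | l <- enum [pred l : shape n | strip l l && (weight l == n)]].

Lemma mem_partns n la : (la \in partns n) = is_partn n la.
Proof.
apply/mapP/idP => [[l + ->]|pla].
  by rewrite mem_enum inE => /andP[ll /eqP wl]; have := shape_partnP ll; rewrite wl.
have [ll wl] := partn_shape_strip pla.
by exists (partn_shape n la); rewrite ?partn_shapeK // mem_enum inE ll wl eqxx.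
Qed.

Lemma partns_uniq n : uniq (partns n).
Proof.
rewrite map_inj_in_uniq ?enum_uniq // => l k; rewrite !mem_enum !inE.
move=> /andP[ll /eqP wl] /andP[kk /eqP wk] lk.
by rewrite -(shape_partnK ll wl) lk shape_partnK.
Qed.

Lemma sum_partns n (F : shape n -> nat) :
  \sum_(la <- partns n) F (partn_shape n la) = \sum_(l | strip l l && (weight l == n)) F l.
Proof.
rewrite big_map big_enum; apply: eq_bigr => l; rewrite inE => /andP[ll /eqP wl].
by rewrite shape_partnK.
Qed.

Lemma Kostka_paths n la mu : is_partn n la -> is_partn n mu ->
  Kostka la mu = paths (size mu) (nth 0 mu) (partn_shape n la).
Proof.
(* The empty content is outside the scope of [card_tableaux_paths]; there the empty tableau is the
   only one. *)
case: mu => [|x mu] pla pmu; last exact: card_tableaux_paths.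
have n0 : n = 0 by case/and3P: pmu => _ _ /eqP.
have [_ wla] := partn_shape_strip pla; rewrite /= wla n0 eqxx.
have sla : size la = 0 by apply/eqP; have := partn_size pla; rewrite n0 leqn0.
have nocell (c : cell la) : False by have := leq_trans (ltn_ord (tag c)) (eq_leq sla).
have T0 (T : {ffun cell la -> 'I_0}) : T = [ffun c => False_rect _ (nocell c)].
  by apply/ffunP => c; case: (nocell c).
rewrite /Kostka (_ : [set T | _] = [set [ffun c => False_rect _ (nocell c)]])%SET ?cards1 //.
apply/setP => T; rewrite !inE [T]T0 eqxx; apply/andP; split.
  by apply/semistandardP => c; case: (nocell c).
by apply/forallP => -[].
Qed.

Lemma paths_perm_eq n m (a b : nat -> nat) (l : shape n) :
  \sum_(i < m) a i <= n -> perm_eq (mkseq a m) (mkseq b m) -> paths m b l = paths m a l.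
Proof.
move=> an ab.
have tE (c : nat -> nat) : mkseq c m = [tuple c i | i < m].
  by rewrite /mkseq -val_enum_ord -map_comp.
have /tuple_permP[s sE] : perm_eq [tuple b i | i < m] [tuple a i | i < m].
  by rewrite -!tE perm_sym.
apply: (paths_perm (s := s)) => // i.
by have := congr1 (fun t : m.-tuple nat => tnth t i) (val_inj sE); rewrite !tnth_mktuple.
Qed.

Lemma sum_count_le w m : \sum_(i < m) count_mem (i : nat) w <= size w.
Proof.
have -> : \sum_(i < m) count_mem (i : nat) w = count (fun x => x < m) w.
  elim: m => [|m IH]; first by rewrite big_ord0 -[LHS](count_pred0 w).
  rewrite big_ord_recr IH /= -count_predUI [X in _ + X](_ : _ = 0) ?addn0.
    by apply: eq_count => x /=; rewrite [in RHS]ltnS [in RHS]leq_eqVlt orbC.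
  apply/eqP; rewrite -leqn0 leqNgt -has_count; apply/hasPn => x _ /=; by case: ltngtP.
exact: count_size.
Qed.

(** Up to order, both sides are the nonzero counts of the letters followed by zeros, and [m] is
    large enough for both. *)
Lemma mkseq_count_perm w m : (forall i, i \in w -> i < m) -> size w <= m ->
  perm_eq (mkseq (fun i => count_mem i w) m) (mkseq (nth 0 (content_type w)) m).
Proof.
move=> wm sw; set z := fun s : seq nat => nseq (m - size s) 0.
have sz s : size s <= m -> mkseq (nth 0 s) m = s ++ z s.
  move=> sm; apply: (@eq_from_nth _ 0).
    by rewrite size_mkseq size_cat size_nseq subnKC.
  move=> i; rewrite size_mkseq => lt_i; rewrite nth_mkseq // nth_cat nth_nseq.
  by case: ltnP => // le_i; rewrite nth_default // if_same.
have sc : size (content_type w) = size (undup w) by rewrite size_sort size_map.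
rewrite sz; last by rewrite sc (leq_trans (size_undup w)).
pose v := [seq i <- iota 0 m | i \notin w].
have pv : perm_eq (iota 0 m) (undup w ++ v).
  apply: uniq_perm; first exact: iota_uniq.
    rewrite cat_uniq undup_uniq filter_uniq ?iota_uniq //= andbT.
    by apply/hasPn => i; rewrite mem_filter /= mem_undup => /andP[].
  move=> i; rewrite mem_cat mem_undup mem_filter mem_iota add0n /=.
  by case: (boolP (i \in w)) => //= /wm ->.
apply: (perm_trans (perm_map _ pv)); rewrite map_cat; apply: perm_cat.
  by rewrite perm_sym perm_sort.
have -> : [seq count_mem i w | i <- v] = nseq (size v) 0.
  apply: (@eq_from_nth _ 0) => [|i]; rewrite size_map ?size_nseq // => lt_i.
  rewrite (nth_map 0) // nth_nseq lt_i; apply/eqP; rewrite -leqn0 leqNgt -has_count has_pred1.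
  by have := mem_nth 0 lt_i; rewrite mem_filter => /andP[].
rewrite /z sc (_ : m - _ = size v) // -[m](size_iota 0) (perm_size pv) size_cat addKn //.
Qed.

(** The place where the symmetry enters: the counts in letter order and the content type are padded
    to the common length [m + n], where they are rearrangements of each other. *)
Lemma paths_content n m la w : is_partn n la -> size w = n -> (forall i, i \in w -> i < m) ->
  paths m (fun i => count_mem i w) (partn_shape n la) = Kostka la (content_type w).
Proof.
move=> pla sw wm; have pw := content_type_partn sw.
rewrite (Kostka_paths pla pw); set mu := content_type w.
have smu : size mu <= n := partn_size pw.
have c0 i : m <= i -> count_mem i w = 0.
  move=> mi; apply/eqP; rewrite -leqn0 leqNgt -has_count has_pred1; apply/negP => /wm.
  by rewrite ltnNge mi.
rewrite -(paths_pad n _ c0) -(paths_pad (m + n - size mu) (a := nth 0 mu)); last first.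
  by move=> i; apply: nth_default.
rewrite subnKC; last by rewrite (leq_trans smu) ?leq_addl.
apply/esym/paths_perm_eq; first by rewrite (leq_trans (sum_count_le _ _)) ?sw.
apply: mkseq_count_perm; last by rewrite sw leq_addl.
by move=> i /wm lt_i; apply: (leq_trans lt_i); apply: leq_addr.
Qed.

Lemma cauchy_Kostka n m nu w : is_partn n nu -> size w = n -> (forall i, i \in w -> i < m) ->
  #|[set A : {ffun 'I_(size nu) -> {ffun 'I_m -> 'I_n.+1}} |
      margins (fun i => count_mem i w) (nth 0 nu) A]|%SET =
  \sum_(la <- partns n) Kostka la (content_type w) * Kostka la nu.
Proof.
move=> pnu sw wm; rewrite -cauchy; last by rewrite -sw sum_count_le.
transitivity (\sum_(la <- partns n) paths m (fun i => count_mem i w) (partn_shape n la) *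
                paths (size nu) (nth 0 nu) (partn_shape n la)); last first.
  rewrite big_seq [RHS]big_seq; apply: eq_bigr => la; rewrite mem_partns => pla.
  by rewrite paths_content // -Kostka_paths.
rewrite (sum_partns (fun l => paths m _ l * paths (size nu) (nth 0 nu) l)).
(* A nonzero chain count forces [l] to be a partition of [n], so the other shapes may be added to
   the sum. *)
rewrite [RHS]big_mkcond; apply: eq_bigr => l _; case: ifP => // nl.
case: (eqVneq (paths (size nu) (nth 0 nu) l) 0) => [->|pl]; first by rewrite muln0.
move: nl; rewrite (paths_strip pl) (paths_weight pl) -sumn_take take_size.
by case/and3P: pnu => _ _ ->.
Qed.

(** * Coefficients of the basic series *)

(** Passage from series to finite counting: the indices giving a fixed monomial are parametrized by
    a subset of a finite type. *)
Lemma monomial_sum_card (I X : choiceType) (A : set I) (mon : I -> X) (x : X)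
    (J : finType) (B : {set J}) (f : J -> I) :
  {in B &, injective f} ->
  (forall i, (A i /\ mon i = x) <-> exists2 j, j \in B & f j = i) ->
  monomial_sum A mon x = #|B|%:R%R.
Proof.
move=> fI fB; rewrite /monomial_sum.
rewrite (_ : (fun i => A i /\ mon i = x) = [set` [seq f j | j <- enum B]])%classic; last first.
  apply/seteqP; split=> i /=.
    by move/fB => [j jB <-]; apply: map_f; rewrite mem_enum.
  by move=> /mapP[j]; rewrite mem_enum => jB ->; apply/fB; exists j.
rewrite -fsbig_seq; last first.
  by rewrite map_inj_in_uniq ?enum_uniq // => i j; rewrite !mem_enum; apply: fI.
by rewrite big_map big_enum /= sumr_const.
Qed.

Lemma monomial_sum0 (I X : choiceType) (A : set I) (mon : I -> X) (x : X) :
  (forall i, A i -> mon i <> x) -> monomial_sum A mon x = 0%R.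
Proof.
by move=> H; rewrite /monomial_sum fsbig1 // => i [/H].
Qed.

(** Size of a finite alphabet containing the letters of [w], a successor so as to fit
    [card_tableaux_paths]. *)
Definition bound (w : seq nat) : nat := (\max_(i <- w) i).+1.

Lemma ltn_bound w i : i \in w -> i < bound w.
Proof. by move=> iw; rewrite ltnS; apply: leq_bigmax_seq. Qed.

Lemma card_cell la : #|{: cell la}| = sumn la.
Proof.
rewrite card_tagged sumnE big_map big_enum /=.
rewrite -[la in RHS](@take_oversize _ (size la)) // sumn_take.
by apply: eq_bigr => i _; rewrite card_ord.
Qed.

Definition content_tableaux la (m : nat) (w : seq nat) : {set {ffun cell la -> 'I_m}} :=
  [set T : {ffun cell la -> 'I_m} | semistandard (fun c => T c) &&
     [forall i : 'I_m, #|[set c | T c == i]| == count_mem (i : nat) w]]%SET.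

Lemma card_content_tableaux n la w : is_partn n la -> size w = n ->
  #|content_tableaux la (bound w) w| = Kostka la (content_type w).
Proof.
move=> pla sw; rewrite -(paths_content pla sw (@ltn_bound w)).
exact: (card_tableaux_paths (\max_(i <- w) i) (fun i => count_mem i w) pla).
Qed.

Lemma schur_coef n la w : is_partn n la ->
  schur la (seq_mset w) = (if size w == n then Kostka la (content_type w) else 0)%N%:R%R.
Proof.
move=> pla; have sla : sumn la = n by case/and3P: pla => _ _ /eqP.
rewrite /schur; case: eqP => sw; last first.
  rewrite monomial_sum0 // => T _ /eq_seq_msetP/perm_size.
  by rewrite size_map -cardE card_cell sla => /esym.
rewrite -(card_content_tableaux pla sw).
apply: (monomial_sum_card (f := fun T : {ffun cell la -> 'I_(bound w)} =>
   [ffun c => T c : nat] : {ffun cell la -> nat})) => [T U _ _ /ffunP TU|T].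
  by apply/ffunP => c; apply: val_inj; have := TU c; rewrite !ffunE.
split=> [[sst /eq_seq_msetP Tw]|[U + <-]].
  have Tb c : T c < bound w.
    by apply: ltn_bound; rewrite -(perm_mem Tw); apply: map_f; rewrite mem_enum.
  exists [ffun c => Ordinal (Tb c)]; last by apply/ffunP => c; rewrite !ffunE.
  rewrite inE; apply/andP; split.
    apply/semistandardP => c d; rewrite !ffunE /=; exact: (semistandardP _ sst c d).
  apply/forallP => i; rewrite -(seq.permP Tw) -fiber_cardE /fiber_card; apply/eqP/eq_card => c.
  by rewrite !inE !ffunE -val_eqE.
rewrite inE => /andP[sst /forallP cnt]; split.
  apply/semistandardP => c d; rewrite !ffunE; exact: (semistandardP _ sst c d).
apply/eq_seq_msetP/allP => i _ /=; apply/eqP; rewrite -fiber_cardE.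
case: (ltnP i (bound w)) => [lt_i|le_i].
  rewrite -(eqP (cnt (Ordinal lt_i))); apply: eq_card => c; by rewrite !inE ffunE -val_eqE.
transitivity 0; last first.
  apply/esym/eqP; rewrite -leqn0 leqNgt -has_count has_pred1; apply/negP => /ltn_bound.
  by rewrite ltnNge le_i.
apply/eqP; rewrite cards_eq0; apply/eqP/setP => c; rewrite !inE ffunE.
by rewrite ltn_eqF // (leq_trans (ltn_ord _)).
Qed.

Lemma Schur_nc_coef n la w : is_partn n la ->
  Schur_nc la w =
    (if size w == n then partn_fact (content_type w) * Kostka la (content_type w) else 0)%N%:R%R.
Proof.
move=> pla; have sla : sumn la = n by case/and3P: pla => _ _ /eqP.
rewrite -sla in pla *; rewrite /Schur_nc; case: eqP => sw; last first.
  by rewrite monomial_sum0 // => -[T b] _ /(congr1 size); rewrite size_word => /esym.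
set m := bound w.
have lt_w (i : 'I_(sumn la)) : letter w i < m by apply/ltn_bound/mem_nth; rewrite sw.
pose wm i : 'I_m := Ordinal (lt_w i).
(* With a reference labelling [ev] fixed, any other one is a permutation followed by [ev], so
   labelled tableaux become pairs of a tableau and a permutation. *)
pose ev (i : 'I_(sumn la)) : cell la := enum_val (cast_ord (esym (card_cell la)) i).
have evB : bijective ev.
  exists (fun c => cast_ord (card_cell la) (enum_rank c)) => i.
    by rewrite /ev enum_valK; apply: val_inj.
  by rewrite /ev cast_ordK enum_rankK.
have evI := bij_inj evB.
pose B := [set p : {ffun cell la -> 'I_m} * 'S_(sumn la) |
  semistandard (fun c => p.1 c) && [forall k, p.1 (ev (p.2 k)) == wm k]]%SET.
have -> : partn_fact (content_type w) * Kostka la (content_type w) = #|B|.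
  rewrite mulnC -(card_content_tableaux pla sw) -sum_nat_const.
  rewrite -sum1_card (partition_big (fun p => p.1) (mem (content_tableaux la m w))) /=; last first.
    move=> [T s]; rewrite !inE /= => /andP[-> /forallP Tw] /=.
    apply/forallP => i; apply/eqP; rewrite -(fiber_card_letter _ sw).
    transitivity (fiber_card wm i); last first.
      by rewrite !fiber_card_sum; apply: eq_bigl => k; rewrite -val_eqE.
    rewrite (@fiber_card_perm _ _ (fun k => T (ev k)) wm s) => [|k]; last by rewrite (eqP (Tw k)).
    rewrite /fiber_card -(card_imset _ evI); apply: eq_card => c; rewrite inE.
    apply/idP/imsetP => [Tc|[k + ->]]; last by rewrite inE.
    by have [f fK evK] := evB; exists (f c); rewrite ?inE evK.
  apply: eq_bigr => T; rewrite inE => /andP[sst /forallP cnt].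
  have fT i : fiber_card (fun k => T (ev k)) i = fiber_card wm i.
    transitivity (count_mem (i : nat) w); last first.
      rewrite -(fiber_card_letter _ sw) !fiber_card_sum; apply: eq_bigl => k.
      by rewrite -val_eqE.
    rewrite -(eqP (cnt i)) /fiber_card -(card_imset _ evI); apply: eq_card => c; rewrite !inE.
    apply/imsetP/idP => [[k + ->]|Tc]; first by rewrite inE.
    by have [f fK evK] := evB; exists (f c); rewrite ?inE evK.
  (* Some permutation makes [T] read as [w]; all of them form a coset of a stabilizer of order
     mu!. *)
  have [s sE] := perm_of_fibers fT.
  have -> : partn_fact (content_type w) = #|stab wm|.
    rewrite -(card_stab_letter sw); apply: eq_card => t; apply/stabP/stabP => H i.
      exact/val_inj/H.
    by have /(congr1 val) := H i.
  rewrite -(card_stab_fibers fT) -(card_stab_transport sE) [RHS]sum1_card.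
  have pI : injective (fun s : 'S_(sumn la) => (T, s)) by move=> s1 s2 [].
  rewrite -(card_imset _ pI); apply: eq_card => -[U u]; rewrite [RHS]inE /= inE /=.
  apply/imsetP/andP => [[t + [-> ->]]|[/andP[_ Tw] /eqP <-]].
    by rewrite inE => Tt; split=> //; apply/andP.
  by exists u => //; rewrite inE.
pose f (p : {ffun cell la -> 'I_m} * 'S_(sumn la)) :
    {ffun cell la -> nat} * {ffun 'I_(sumn la) -> cell la} :=
  ([ffun c => p.1 c : nat], [ffun k => ev (p.2 k)]).
refine (monomial_sum_card (B := B) (f := f) _ _) => [[T s] [U t] _ _|[T b]] /=.
  case=> /ffunP TU /ffunP st; congr pair.
    by apply/ffunP => c; apply: val_inj; have := TU c; rewrite !ffunE.
  by apply/permP => k; apply: evI; have := st k; rewrite !ffunE.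
split=> [[[/= sst bB] bw]|[[U s] + [<- <-]]].
  have Tw k : T (b k) = letter w k by rewrite -[in RHS]bw letter_word.
  have [b1 fK bK] := bB.
  have Tb c : T c < m by rewrite -[c]bK Tw.
  have [g gK evK] := evB.
  have sI : injective (fun k => g (b k)) by move=> i j /(bij_inj (Bijective evK gK))/(bij_inj bB).
  exists ([ffun c => Ordinal (Tb c)], perm sI).
    rewrite inE /=; apply/andP; split.
      apply/semistandardP => c d; rewrite !ffunE /=; exact: (semistandardP _ sst c d).
    by apply/forallP => k; rewrite ffunE permE evK -val_eqE /= Tw.
  by congr pair; apply/ffunP => c; rewrite !ffunE //= permE evK.
rewrite inE /= => /andP[sst /forallP Tw]; split; [split=> /=|].
- apply/semistandardP => c d; rewrite !ffunE; exact: (semistandardP _ sst c d).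
- apply: (eq_bij (f := ev \o s)); last by move=> k; rewrite ffunE.
  by apply: bij_comp evB (injF_bij (@perm_inj _ s)).
rewrite -[RHS](word_letter sw); apply: eq_word => k.
by rewrite !ffunE (eqP (Tw k)).
Qed.

Definition ker (n : nat) (X : eqType) (f : 'I_n -> X) : {set {set 'I_n}} :=
  finset.preim_partition f [set: 'I_n]%SET.

Lemma eq_ker n (X Y : eqType) (f : 'I_n -> X) (g : 'I_n -> Y) :
  (forall i j, (f i == f j) = (g i == g j)) -> ker f = ker g.
Proof.
move=> fg; apply: eq_in_imset => i _; apply/setP => j; by rewrite !inE fg.
Qed.

Lemma set_partition_ker n (X : eqType) (f : 'I_n -> X) : set_partition (ker f).
Proof. exact: preim_partitionP. Qed.

Lemma set_partition_eq_ker n (X : eqType) (f : 'I_n -> X) (P : {set {set 'I_n}}) :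
  set_partition P ->
  (forall j k, f j = f k <-> k \in finset.pblock P j) <-> P = ker f.
Proof.
move=> PP; split=> [H|-> j k]; last by rewrite preim_pblock; split=> /eqP.
have /and3P[/eqP covP trP _] := PP.
have <- : equivalence_partition (fun x y => y \in finset.pblock P x) [set: 'I_n]%SET = P.
  exact: equivalence_partition_pblock.
apply: eq_in_imset => i _; apply/setP => j; rewrite !inE /=.
by apply/idP/eqP => /H.
Qed.

Lemma m_nc_coef n (P : {set {set 'I_n}}) w : set_partition P ->
  m_nc P w = ((size w == n) && (ker (@letter n w) == P))%:R%R.
Proof.
move=> PP; rewrite /m_nc; case: eqP => sw /=; last first.
  by rewrite monomial_sum0 // => t _ tw; apply: sw; rewrite -tw size_tuple.
have sw' : size w == n by apply/eqP.
(* Only the tuple [w] itself can contribute, so a subset of [unit] serves as the finite index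
   set. *)
have -> : nat_of_bool (ker (@letter n w) == P) =
    #|[set x : unit | ker (@letter n w) == P]%SET|.
  case: (_ == P); first by rewrite -[LHS]card_unit -cardsT; apply: eq_card => x; rewrite !inE.
  by apply/esym/eqP; rewrite cards_eq0; apply/eqP/setP => x; rewrite !inE.
apply: (monomial_sum_card (f := fun _ : unit => Tuple sw')) => [[] []//|t].
have lE (t' : n.-tuple nat) : (t' : seq nat) = w -> forall j, tnth t' j = letter w j.
  by move=> <- j; rewrite /letter (tnth_nth 0).
split=> [[Ht tw]|[[] + <-]].
  exists tt; last exact: val_inj.
  rewrite inE eq_sym; apply/eqP/set_partition_eq_ker => // j k.
  by rewrite -!(lE t).
rewrite inE => /eqP kP; split=> //= j k; rewrite !(lE (Tuple sw')) //.
by have := (@set_partition_eq_ker _ _ (@letter n w) P PP).2 (esym kP) j k.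
Qed.

Lemma h_nc_coef n (P : {set {set 'I_n}}) w :
  h_nc P w = (if size w == n then
    #|[set L : {set 'I_n * 'I_n} |
        `[< block_orders (partition_meet (ker (@letter n w)) P) L >]]%SET| else 0)%N%:R%R.
Proof.
rewrite /h_nc; case: eqP => sw; last first.
  by rewrite monomial_sum0 // => -[f L] _ /(congr1 size); rewrite size_word => /esym.
pose lw : {ffun 'I_n -> nat} := [ffun i => letter w i].
have kE : kernel lw = ker (@letter n w) by apply: eq_ker => i j; rewrite !ffunE.
pose F (L : {set 'I_n * 'I_n}) : {ffun 'I_n -> nat} * {set 'I_n * 'I_n} := (lw, L).
refine (monomial_sum_card (f := F) _ _) => [L1 L2 _ _ []//|[f L]] /=.
split=> [[bo fw]|[L' + [<- <-]]].
  have fE : f = lw by apply/ffunP => i; rewrite ffunE -fw -/(word f) letter_word.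
  by exists L; rewrite /F -?fE // inE; apply/asboolP; rewrite -kE -fE.
rewrite inE => /asboolP bo; split; first by rewrite kE.
rewrite -[RHS](word_letter sw); apply: eq_word => i; by rewrite ffunE.
Qed.

Lemma block_type_ker n w : size w = n -> block_type (ker (@letter n w)) = content_type w.
Proof.
move=> sw; apply: sort_geq_perm.
pose F (x : nat) : {set 'I_n} := [set i | letter w i == x]%SET.
have FE x : #|F x| = count_mem x w by rewrite -(fiber_card_letter x sw).
have -> : [seq count_mem i w | i <- undup w] = [seq #|(B : {set 'I_n})| | B <- [seq F i | i <- undup w]].
  by rewrite -map_comp; apply: eq_map => x /=; rewrite FE.
apply/perm_map/uniq_perm; first exact: enum_uniq.
  rewrite map_inj_in_uniq ?undup_uniq // => x y; rewrite !mem_undup => xw _ Fxy.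
  have : F x != finset.set0 by rewrite -card_gt0 FE -has_count has_pred1.
  case/set0Pn => i iF; have : i \in F y by rewrite -Fxy.
  by move: iF; rewrite !inE => /eqP <- /eqP <-.
move=> B; rewrite mem_enum; apply/imsetP/mapP => [[i _ ->]|[x]].
  exists (letter w i); first by rewrite mem_undup mem_nth // sw.
  by apply/setP => j; rewrite !inE eq_sym.
rewrite mem_undup => xw ->; have lt_x : index x w < n by rewrite -sw index_mem.
exists (Ordinal lt_x) => //; apply/setP => j; by rewrite !inE /letter /= nth_index // eq_sym.
Qed.

Lemma sum_m_nc_coef n mu w :
  ((\sum_(P : {set {set 'I_n}} | set_partition P && (block_type P == mu)) m_nc P : ncseries) w =
   ((size w == n) && (content_type w == mu))%:R)%R.
Proof.
rewrite fct_sumE (eq_bigr (fun P => ((size w == n) && (ker (@letter n w) == P))%:R%R)); last first.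
  by move=> P /andP[PP _]; rewrite m_nc_coef.
case: eqP => sw /=; last by rewrite big1.
rewrite -(block_type_ker sw); case: (boolP (block_type _ == mu)) => bt.
  rewrite (bigD1 (ker (@letter n w))) /=; last by rewrite bt set_partition_ker.
  by rewrite eqxx big1 ?addr0 // => P /andP[_]; rewrite eq_sym => /negPf ->.
rewrite big1 // => P /andP[_ /eqP btP]; case: eqP => // kP.
by move: bt; rewrite kP btP eqxx.
Qed.

Lemma m_comm_coef mu w : m_comm mu (seq_mset w) = (content_type w == mu)%:R%R.
Proof.
have ct (e : {mset nat}%mset) : sort geq [seq e i | i <- undup e] = content_type e.
  by congr sort; apply: eq_map => i; rewrite -mset_seqE seq_mset_id.
have ctw : content_type (seq_mset w) = content_type w.
  by apply: content_type_perm; apply: perm_eq_seq_mset.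
rewrite /m_comm; case: eqP => cw; last first.
  by rewrite monomial_sum0 // => e + ew; rewrite /= ct ew ctw.
rewrite (monomial_sum_card (B := [set: unit]%SET) (f := fun _ => seq_mset w)).
- by rewrite cardsT card_unit.
- by move=> [] [].
- move=> e; split=> [[_ <-]|[_ _ <-]]; first by exists tt.
  by rewrite /= ct ctw.
Qed.

(** * Expansions in Pi and Lambda *)

Local Open Scope ring_scope.

Lemma Pi_alg0 : Pi_alg 0.
Proof. by split=> //; exists 0. Qed.

Lemma Pi_alg_lin (a : rat) (f g : ncseries) : Pi_alg f -> Pi_alg g -> Pi_alg (a *: f + g).
Proof.
move=> [[d fd] fp] [[e ge] gp]; split.
  exists (maxn d e) => w; rewrite gtn_max => /andP[dw ew].
  by rewrite -[LHS]/(a * f w + g w) fd // ge // mulr0 addr0.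
by move=> p pb w; rewrite -[LHS]/(a * f _ + g _) fp // gp.
Qed.

Lemma Lambda_alg0 : Lambda_alg 0.
Proof. by split=> //; exists 0. Qed.

Lemma Lambda_alg_lin (a : rat) (f g : cseries) :
  Lambda_alg f -> Lambda_alg g -> Lambda_alg (a *: f + g).
Proof.
move=> [[d fd] fp] [[e ge] gp]; split.
  exists (maxn d e) => w; rewrite gtn_max => /andP[dw ew].
  by rewrite -[LHS]/(a * f w + g w) fd // ge // mulr0 addr0.
by move=> p pb w; rewrite -[LHS]/(a * f _ + g _) fp // gp.
Qed.

Lemma Pi_alg_homogeneous (n : nat) (f : ncseries) :
  (forall w, size w <> n -> f w = 0) ->
  (forall p : nat -> nat, injective p -> forall w, size w = n -> f [seq p i | i <- w] = f w) ->
  Pi_alg f.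
Proof.
move=> f0 fp; split=> [|p pb w]; first by exists n => w nw; apply: f0 => wn; rewrite wn ltnn in nw.
case: (eqVneq (size w) n) => [sw|/eqP sw]; first by apply: fp => //; apply: bij_inj.
by rewrite !f0 // size_map.
Qed.

Lemma Schur_nc_Pi n la : is_partn n la -> Pi_alg (Schur_nc la).
Proof.
move=> pla; apply: (@Pi_alg_homogeneous n) => [w /eqP/negPf sw|p pI w sw].
  by rewrite (Schur_nc_coef w pla) sw.
by rewrite !(Schur_nc_coef _ pla) size_map content_type_map.
Qed.

Lemma ker_letter_map n p w : injective p -> size w = n ->
  ker (@letter n [seq p i | i <- w]) = ker (@letter n w).
Proof.
move=> pI sw; apply: eq_ker => i j; rewrite /letter !(nth_map 0%N) ?sw //.
by rewrite (inj_eq pI).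
Qed.

Lemma m_nc_Pi n (P : {set {set 'I_n}}) : set_partition P -> Pi_alg (m_nc P).
Proof.
move=> PP; apply: (@Pi_alg_homogeneous n) => [w /eqP/negPf sw|p pI w sw].
  by rewrite m_nc_coef // sw.
by rewrite !m_nc_coef // size_map ker_letter_map.
Qed.

Lemma h_nc_Pi n (P : {set {set 'I_n}}) : Pi_alg (h_nc P).
Proof.
apply: (@Pi_alg_homogeneous n) => [w /eqP/negPf sw|p pI w sw].
  by rewrite h_nc_coef sw.
by rewrite !h_nc_coef size_map ker_letter_map.
Qed.

Lemma m_comm_Lambda mu : Lambda_alg (m_comm mu).
Proof.
split=> [|p pb e].
  exists (sumn mu) => e se; rewrite -[e]seq_mset_id m_comm_coef.
  case: eqP => // cmu; move: se; rewrite -cmu.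
  have := content_type_partn (erefl (size e)) => /and3P[_ _ /eqP ->].
  by rewrite ltnn.
by rewrite -[in RHS](seq_mset_id e) !m_comm_coef content_type_map //; apply: bij_inj.
Qed.

(** The lifting map and the bilinear form are linear only on a subspace, so membership in [D] is
    carried through the induction. *)
Lemma linear_on_sum (V W : lmodType rat) (D : V -> Prop) (L : V -> W) :
  D 0 -> (forall a f g, D f -> D g -> D (a *: f + g)) ->
  (forall a f g, D f -> D g -> L (a *: f + g) = a *: L f + L g) ->
  forall (I : eqType) (r : seq I) (c : I -> rat) (F : I -> V), {in r, forall i, D (F i)} ->
  L (\sum_(i <- r) c i *: F i) = \sum_(i <- r) c i *: L (F i).
Proof.
move=> D0 DD LL I r c F; elim: r => [_|x r IH DF].
  (* Linearity at 1 and 0 gives [L 0 = L 0 + L 0], hence [L 0 = 0]. *)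
  rewrite !big_nil; have := LL 1 0 0 D0 D0; rewrite !scale1r addr0 => /esym/eqP.
  by rewrite -subr_eq0 addrK => /eqP.
have Dr : {in r, forall i, D (F i)} by move=> i ir; apply: DF; rewrite inE ir orbT.
rewrite !big_cons LL ?IH //; first by apply: DF; rewrite mem_head.
elim: r Dr {IH DF} => [|y r IH] Dr; first by rewrite big_nil.
rewrite big_cons; apply: DD; first by apply: Dr; rewrite mem_head.
by apply: IH => i ir; apply: Dr; rewrite inE ir orbT.
Qed.

Lemma Schur_nc_m n la : is_partn n la ->
  Schur_nc la = \sum_(P <- enum [pred P : {set {set 'I_n}} | set_partition P])
    (partn_fact (block_type P) * Kostka la (block_type P))%N%:R *: m_nc P.
Proof.
move=> pla; apply/funext => w; rewrite (Schur_nc_coef w pla) fct_sumE.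
rewrite big_seq (eq_bigr (fun P => (partn_fact (block_type P) * Kostka la (block_type P))%N%:R *
    ((size w == n) && (ker (@letter n w) == P))%:R)); last first.
  by move=> P; rewrite mem_enum inE => PP; rewrite -m_nc_coef.
rewrite -big_seq big_enum /=; case: eqP => sw /=; last by rewrite big1 // => P _; rewrite mulr0.
rewrite (bigD1 (ker (@letter n w))) /=; last exact: set_partition_ker.
rewrite eqxx mulr1 block_type_ker // big1 ?addr0 // => P /andP[_].
by rewrite eq_sym => /negPf ->; rewrite mulr0.
Qed.

Lemma Schur_nc_partns n la : is_partn n la ->
  Schur_nc la = \sum_(mu <- partns n) (partn_fact mu * Kostka la mu)%N%:R *:
     (\sum_(P : {set {set 'I_n}} | set_partition P && (block_type P == mu)) m_nc P).
Proof.
move=> pla; apply/funext => w; rewrite (Schur_nc_coef w pla) fct_sumE.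
rewrite (eq_bigr (fun mu => (partn_fact mu * Kostka la mu)%N%:R *
    ((size w == n) && (content_type w == mu))%:R)); last first.
  by move=> mu _; rewrite -sum_m_nc_coef.
case: eqP => sw /=; last by rewrite big1 // => P _; rewrite mulr0.
rewrite (bigD1_seq (content_type w)) ?partns_uniq ?mem_partns ?content_type_partn //=.
by rewrite eqxx mulr1 big1 ?addr0 // => mu; rewrite eq_sym => /negPf ->; rewrite mulr0.
Qed.

Lemma schur_m_comm n la : is_partn n la ->
  schur la = \sum_(mu <- partns n) (Kostka la mu)%:R *: m_comm mu.
Proof.
move=> pla; apply/funext => e; rewrite fct_sumE -[e]seq_mset_id (schur_coef _ pla).
rewrite (eq_bigr (fun mu => (Kostka la mu)%:R * (content_type e == mu)%:R)); last first.
  by move=> mu _; rewrite -m_comm_coef.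
case: eqP => sw /=.
  rewrite (bigD1_seq (content_type e)) ?partns_uniq ?mem_partns ?content_type_partn //=.
  by rewrite eqxx mulr1 big1 ?addr0 // => mu; rewrite eq_sym => /negPf ->; rewrite mulr0.
rewrite big_seq big1 // => mu; rewrite mem_partns => pmu; case: eqP => [cmu|]; last by rewrite mulr0.
case: sw; have /and3P[_ _ /eqP <-] := pmu.
by rewrite -cmu; have /and3P[_ _ /eqP ->] := content_type_partn (erefl (size e)).
Qed.

Lemma card_content_class n nu : is_partn n nu ->
  (#|[set g : {ffun 'I_n -> 'I_(size nu)} | [forall y, fiber_card g y == nth 0%N nu y]]%SET|
     * partn_fact nu)%N = n`!.
Proof.
move=> pnu; have [g0 g0E] := exists_content_map pnu.
rewrite -(card_fiber_class g0); congr (_ * _)%N.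
  apply: eq_card => g; rewrite !inE; apply: eq_forallb => y; by rewrite g0E.
have cw := content_type_eq pnu (count_word_ord g0E (fun i => @nth_default _ 0%N nu i)).
rewrite -{1}cw -(card_stab_letter (size_word _)); apply: eq_card => s.
apply/stabP/stabP => H i; first by apply: val_inj; have := H i; rewrite !letter_word.
by rewrite !letter_word H.
Qed.

Lemma block_type_content n nu (g : {ffun 'I_n -> 'I_(size nu)}) : is_partn n nu ->
  (forall y, fiber_card g y = nth 0%N nu y) -> block_type (ker g) = nu.
Proof.
move=> pnu gE.
rewrite -[RHS](content_type_eq pnu (count_word_ord gE (fun i => @nth_default _ 0%N nu i))).
rewrite -(block_type_ker (size_word _)); congr block_type; apply: eq_ker => i j.
by rewrite !letter_word.
Qed.

(** Counterpart of the classical expansion of h_nu in Schur functions. At a word [w] each term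
    counts a stabilizer, [sum_card_stab] turns the total into mu! times a number of matrices, and
    [cauchy_Kostka] expands that number. The scalar 1 gives the sum the form that [linear_on_sum]
    expects. *)
Lemma sum_h_nc n nu : is_partn n nu ->
  \sum_(g <- enum [pred g : {ffun 'I_n -> 'I_(size nu)} | [forall y, fiber_card g y == nth 0%N nu y]])
     1 *: h_nc (ker g) =
  \sum_(mu <- partns n) (Kostka mu nu)%:R *: Schur_nc mu.
Proof.
move=> pnu; apply/funext => w; rewrite !fct_sumE.
transitivity (\sum_(mu <- partns n) (Kostka mu nu)%:R *
   (if size w == n then partn_fact (content_type w) * Kostka mu (content_type w) else 0)%N%:R : rat);
   last first.
  rewrite big_seq [RHS]big_seq; apply: eq_bigr => mu; rewrite mem_partns => pmu.
  by rewrite -(Schur_nc_coef w pmu).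
case: eqP => sw; last first.
  rewrite big1 => [|g _]; first by rewrite big1 // => mu _; rewrite mulr0.
  by rewrite scale1r h_nc_coef; case: eqP.
have lt_w (i : 'I_n) : (letter w i < bound w)%N by apply/ltn_bound/mem_nth; rewrite sw.
pose wm i : 'I_(bound w) := Ordinal (lt_w i).
have wmE x : fiber_card wm x = count_mem (x : nat) w.
  rewrite -(fiber_card_letter _ sw) !fiber_card_sum; apply: eq_bigl => k.
  by rewrite -val_eqE.
have stabE (g : {ffun 'I_n -> 'I_(size nu)}) :
    (1 *: h_nc (ker g)) w = #|stab (fun i => (wm i, g i))|%:R.
  rewrite scale1r h_nc_coef sw eqxx /ker partition_meet_preim; congr (_%:R).
  transitivity #|stab (fun i => (letter w i, g i))|.
    rewrite -card_fiber_orders; apply: eq_card => L; rewrite !inE.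
    by apply: asbool_equiv_eq; apply: block_ordersP.
  apply: eq_card => s; apply/stabP/stabP => H i.
    by have [h1 ->] := H i; congr pair; apply: val_inj.
  by have [h1 ->] := H i; congr pair.
rewrite (eq_bigr _ (fun g _ => stabE g)) big_enum /= -natr_sum.
rewrite (sum_card_stab wm (fun y : 'I_(size nu) => nth 0%N nu y)).
have -> : #|stab wm| = partn_fact (content_type w).
  rewrite -(card_stab_letter sw); apply: eq_card => t; apply/stabP/stabP => H i.
    by have /(congr1 val) := H i.
  exact/val_inj/H.
have := cauchy_Kostka pnu sw (@ltn_bound w).
rewrite [X in _ -> (_ * X)%N%:R = _](_ : _ =
  #|[set A : {ffun 'I_(size nu) -> {ffun 'I_(bound w) -> 'I_n.+1}} |
      margins (fun i => count_mem i w) (nth 0%N nu) A]%SET|); last first.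
  apply: eq_card => A; rewrite !inE /margins; congr (_ && _).
  by apply: eq_forallb => x; rewrite wmE.
move=> ->; rewrite natrM natr_sum big_distrr; apply: eq_bigr => mu _ /=.
by rewrite -!natrM mulnA mulnC.
Qed.

Local Open Scope classical_set_scope.
Local Open Scope ring_scope.

(** * Dominance and linear independence *)

Lemma exists_maximizer (T : eqType) (s : seq T) (v : T -> nat) :
  s <> [::] -> exists2 x, x \in s & forall y, y \in s -> (v y <= v x)%N.
Proof.
elim: s => [//|x s IH] _; case: s IH => [|y s] IH.
  by exists x; rewrite ?mem_head // => z; rewrite inE => /eqP ->.
have [//|z zs zM] := IH; case: (leqP (v x) (v z)) => [xz|/ltnW zx].
  exists z; first by rewrite inE zs orbT.
  by move=> t; rewrite inE => /orP[/eqP -> //|/zM].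
exists x; first exact: mem_head.
by move=> t; rewrite inE => /orP[/eqP -> //|/zM tz]; apply: leq_trans zx.
Qed.

(** The sum of all partial sums grows strictly along dominance, so a maximal element for this
    partial order is found by maximizing a number. As [N] exceeds both sizes, the partial sums below
    [N] determine the partitions. *)
Lemma dominated_eq (n m N : nat) (la mu : seq nat) : is_partn n la -> is_partn m mu ->
  dominated la mu -> (size la < N)%N -> (size mu < N)%N ->
  (\sum_(k < N) sumn (take k mu) <= \sum_(k < N) sumn (take k la))%N -> la = mu.
Proof.
move=> pla pmu dom laN muN le_sum.
have H (k : 'I_N) : true -> (sumn (take k la) <= sumn (take k mu) ?= iff
    (sumn (take k la) == sumn (take k mu)))%N by move=> _; split=> //; apply: dom.
have /leqif_refl/forallP E : (\sum_(k < N) sumn (take k la) <= \sum_(k < N) sumn (take k la) ?= iff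
    [forall k : 'I_N, sumn (take k la) == sumn (take k mu)])%N.
  have := leqif_sum H; rewrite (_ : (\sum_(k < N) sumn (take k mu) = \sum_(k < N) sumn (take k la))%N) //.
  by apply/eqP; rewrite eqn_leq le_sum leq_sum // => k _; apply: dom.
apply: (partn_ext pla pmu) => i; case: (ltnP i.+1 N) => [lt_i|le_N].
  have /eqP := E (Ordinal lt_i); have /eqP := E (Ordinal (ltnW lt_i)).
  by rewrite /= !sumn_take !big_ord_recr /= => -> /addnI.
by rewrite !nth_default // -ltnS; [apply: leq_trans muN le_N | apply: leq_trans laN le_N].
Qed.

(* Among the [la] with [c la != 0] take one that is maximal for dominance: the
   coefficient of a word of content [la] only sees [c la]. *)
Lemma Schur_nc_free (s : seq (seq nat)) (c : seq nat -> rat) : uniq s ->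
  (forall la, la \in s -> is_partn (sumn la) la) ->
  \sum_(la <- s) c la *: Schur_nc la = 0 ->
  forall la, la \in s -> c la = 0.
Proof.
move=> us ps sum0 la0 la0s; apply/eqP; apply: contraT => c0.
pose N := (\max_(la <- s) size la).+1.
have sN la : la \in s -> (size la < N)%N by move=> ls; rewrite ltnS; apply: leq_bigmax_seq.
have [|la + laM] := @exists_maximizer _ [seq la <- s | c la != 0]
    (fun la => \sum_(k < N) sumn (take k la))%N.
  by move=> E; have : la0 \in [seq la <- s | c la != 0]; [rewrite mem_filter c0|rewrite E].
rewrite mem_filter => /andP[cla las]; have pla := ps _ las.
have [f fE] := exists_content_map pla; pose w := word (fun j => f j : nat).
have cw : content_type w = la.
  exact: content_type_eq pla (count_word_ord fE (fun i => @nth_default _ 0%N la i)).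
have /(congr1 (fun F : ncseries => F w)) := sum0.
rewrite fct_sumE (bigD1_seq la) //= big1_seq => [|mu /andP[mula mus]].
  rewrite addr0 -[LHS]/(c la * _) (Schur_nc_coef w pla) size_word eqxx cw => /eqP.
  rewrite mulf_eq0 (negPf cla) /= Num.Theory.pnatr_eq0 muln_eq0.
  rewrite -[_ || _]negbK negb_or -!lt0n Kostka_diag andbT prodn_gt0 // => i; exact: fact_gt0.
rewrite -[LHS]/(c mu * _); case: (eqVneq (c mu) 0) => [->|cmu]; first by rewrite mul0r.
rewrite (Schur_nc_coef w (ps _ mus)) cw; case: eqP => _; last by rewrite mulr0.
case: (eqVneq (Kostka mu la) 0%N) => [->|Kml]; first by rewrite muln0 mulr0.
case/eqP: mula; apply/esym.
apply: (dominated_eq (N := N) pla (ps _ mus) (Kostka_dominated (ps _ mus) Kml)).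
- exact: sN.
- exact: sN.
- by apply: laM; rewrite mem_filter cmu.
Qed.

(** * The commutative image, the lifting map and the bilinear form *)

Lemma rho_Schur_nc n la : is_partn n la -> rho (Schur_nc la) = (n`!%:R : rat) *: schur la.
Proof.
move=> pla; apply/funext => e; rewrite -[e]seq_mset_id; set w := (e : seq nat).
rewrite -[RHS]/(n`!%:R * schur la (seq_mset w)) (schur_coef _ pla) /rho.
have set_perm : [set v : seq nat | seq_mset v = seq_mset w] = [set v | perm_eq v w].
  by apply/seteqP; split=> v /= /eq_seq_msetP.
rewrite set_perm; case: eqP => sw; last first.
  rewrite mulr0 fsbig1 // => v /= /perm_size vw.
  by rewrite (Schur_nc_coef v pla) vw; case: eqP.
have lt_w (i : 'I_n) : (letter w i < bound w)%N by apply/ltn_bound/mem_nth; rewrite sw.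
pose wm i : 'I_(bound w) := Ordinal (lt_w i).
(* [C] encodes the n!/mu! rearrangements of [w]. All carry the coefficient mu! K, whence the factor
   n!. *)
pose C := [set g : {ffun 'I_n -> 'I_(bound w)} | [forall y, fiber_card g y == fiber_card wm y]]%SET.
have fcE (g : 'I_n -> 'I_(bound w)) y : fiber_card g y = count_mem (y : nat) (word (fun i => g i : nat)).
  rewrite -fiber_cardE !fiber_card_sum; apply: eq_bigl => k; by rewrite -val_eqE.
have wmw : word (fun i => wm i : nat) = w by rewrite -[RHS](word_letter sw); apply: eq_word.
have permC (g : {ffun 'I_n -> 'I_(bound w)}) : g \in C -> perm_eq (word (fun i => g i : nat)) w.
  rewrite inE => /forallP gE; apply/allP => i _ /=; case: (ltnP i (bound w)) => [lt_i|le_i].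
    by have := gE (Ordinal lt_i); rewrite !fcE wmw.
  have out (h : 'I_n -> 'I_(bound w)) : count_mem i (word (fun i => h i : nat)) = 0%N.
    apply/eqP; rewrite -leqn0 leqNgt -has_count has_pred1; apply/mapP => -[j _ ij].
    by move: le_i; rewrite ij leqNgt ltn_ord.
  by rewrite out -wmw out.
pose wd (g : {ffun 'I_n -> 'I_(bound w)}) : seq nat := word (fun i => g i : nat).
rewrite (_ : [set v | perm_eq v w] = [set` [seq wd g | g <- enum C]]); last first.
  apply/seteqP; split=> v /=.
    move=> vw; have sv : size v = n by rewrite (perm_size vw).
    have lt_v (i : 'I_n) : (letter v i < bound w)%N.
      by apply: ltn_bound; rewrite -(perm_mem vw); apply: mem_nth; rewrite sv.
    pose vm : {ffun 'I_n -> 'I_(bound w)} := [ffun i => Ordinal (lt_v i)].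
    have vmv : word (fun i => vm i : nat) = v.
      by rewrite -[RHS](word_letter sv); apply: eq_word => i; rewrite ffunE.
    apply/mapP; exists vm => //; rewrite mem_enum inE; apply/forallP => y.
    by rewrite !fcE vmv wmw (seq.permP vw).
  by move=> /mapP[g]; rewrite mem_enum => /permC gC ->.
have wI : injective wd.
  move=> g h gh; apply/ffunP => i; apply: val_inj.
  by rewrite /= -(letter_word (fun i => g i : nat)) -/(wd g) gh letter_word.
rewrite -fsbig_seq ?map_inj_uniq ?enum_uniq // big_map big_enum /=.
rewrite (eq_bigr (fun _ => (partn_fact (content_type w) * Kostka la (content_type w))%N%:R : rat)); last first.
  move=> g /permC gw; rewrite (Schur_nc_coef _ pla) size_word eqxx.
  by rewrite (content_type_perm gw).
rewrite sumr_const -(card_fiber_class wm) -/C.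
have -> : #|stab wm| = partn_fact (content_type w).
  rewrite -(card_stab_letter sw); apply: eq_card => t; apply/stabP/stabP => H i.
    by have /(congr1 val) := H i.
  exact/val_inj/H.
by rewrite -natrM -mulrnA mulnC mulnA.
Qed.

Lemma lifting_schur (R : cseries -> ncseries) n la : is_lifting_map R -> is_partn n la ->
  R ((n`!%:R : rat) *: schur la) = Schur_nc la.
Proof.
case=> _ Rlin Rm pla.
have sumE (c : seq nat -> rat) : R (\sum_(mu <- partns n) c mu *: m_comm mu) =
    \sum_(mu <- partns n) c mu *: R (m_comm mu).
  apply: (linear_on_sum Lambda_alg0 Lambda_alg_lin Rlin) => mu _; exact: m_comm_Lambda.
rewrite (schur_m_comm pla) scaler_sumr.
under eq_bigr do rewrite scalerA.
rewrite sumE (Schur_nc_partns pla) big_seq [RHS]big_seq; apply: eq_bigr => mu.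
rewrite mem_partns => pmu; rewrite (Rm _ _ pmu) scalerA; congr (_ *: _).
have nz : (n`!%:R : rat) != 0 by rewrite Num.Theory.pnatr_eq0 -lt0n fact_gt0.
by rewrite mulrACA [n`!%:R * _]mulrC mulrAC mulrA -natrM mulnC divfK.
Qed.

Lemma Pi_form_Schur_h (B : ncseries -> ncseries -> rat) n la (Q : {set {set 'I_n}}) :
  is_Pi_form B -> is_partn n la -> set_partition Q ->
  B (Schur_nc la) (h_nc Q) = (n`! * (partn_fact (block_type Q) * Kostka la (block_type Q)))%N%:R.
Proof.
case=> Bl _ BE _ pla PQ; rewrite (Schur_nc_m pla).
rewrite (linear_on_sum (W := rat^o) (L := fun f => B f (h_nc Q)) Pi_alg0 Pi_alg_lin).
- rewrite (eq_big_seq (fun P => (n`! * (partn_fact (block_type P) * Kostka la (block_type P)))%N%:R *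
      (P == Q)%:R)) => [|P]; last first.
    rewrite mem_enum inE => PP; rewrite BE //.
    rewrite -[LHS]/((partn_fact (block_type P) * Kostka la (block_type P))%N%:R *
      (n`!%:R * (P == Q)%:R) : rat).
    by rewrite mulrA -natrM mulnC.
  rewrite big_enum (bigD1 Q) //= eqxx mulr1 big1 ?addr0 // => P /andP[_ /negPf ->].
  by rewrite mulr0.
- by move=> a f g Pf Pg; apply: Bl => //; apply: h_nc_Pi.
- by move=> P; rewrite mem_enum inE; apply: m_nc_Pi.
Qed.

Lemma Pi_form_Schur (B : ncseries -> ncseries -> rat) n la mu :
  is_Pi_form B -> is_partn n la -> is_partn n mu ->
  B (Schur_nc la) (Schur_nc mu) = n`!%:R ^+ 2 * (la == mu)%:R.
Proof.
move=> fB pla pmu; have [_ Br _ _] := fB.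
(* The deviation from the claimed value; it is shown to solve a homogeneous linear system. *)
pose x nu : rat := B (Schur_nc la) (Schur_nc nu) - n`!%:R ^+ 2 * (la == nu)%:R.
have PiS : Pi_alg (Schur_nc la) by exact: Schur_nc_Pi pla.
have Bsum (I : eqType) (r : seq I) (c : I -> rat) F : {in r, forall i, Pi_alg (F i)} ->
    B (Schur_nc la) (\sum_(i <- r) c i *: F i) = \sum_(i <- r) c i * B (Schur_nc la) (F i).
  apply: (linear_on_sum (W := rat^o) (L := B (Schur_nc la)) Pi_alg0 Pi_alg_lin).
  by move=> a f g Pf Pg; apply: Br.
have key nu : is_partn n nu -> \sum_(ka <- partns n) (Kostka ka nu)%:R * x ka = 0.
  move=> pnu; have := congr1 (B (Schur_nc la)) (sum_h_nc pnu).
  rewrite !Bsum; [|by move=> ka; rewrite mem_partns; apply: Schur_nc_Pi|by move=> g _; apply: h_nc_Pi].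
  rewrite (eq_big_seq (fun _ => (n`! * (partn_fact nu * Kostka la nu))%N%:R)) => [|g]; last first.
    rewrite mem_enum inE => /forallP gE; rewrite mul1r Pi_form_Schur_h ?set_partition_ker //.
    by rewrite block_type_content // => y; apply/eqP.
  rewrite big_enum /= sumr_const -mulrnA.
  (* The number of maps [g] of content nu, times the nu! coming from the pairing, is a second n!. *)
  rewrite (_ : (_ * #|_|)%N = (n`! ^ 2 * Kostka la nu)%N); last first.
    rewrite -mulnn -{2}(card_content_class pnu) cardsE.
    by rewrite [LHS]mulnC -!mulnA; congr (_ * _)%N; apply: mulnCA.
  move=> E; under eq_bigr do rewrite mulrBr.
  rewrite sumrB -E (bigD1_seq la) ?mem_partns ?partns_uniq //= eqxx mulr1.
  rewrite big1 => [|ka]; last by rewrite eq_sym => /negPf ->; rewrite !mulr0.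
  by rewrite addr0 natrM natrX mulrC subrr.
(* Instead of inverting the Kostka matrix, use the independence of the functions S: by [key], every
   coefficient of the combination with scalars [x] vanishes. *)
have /(_ mu) : forall nu, nu \in partns n -> x nu = 0.
  apply: Schur_nc_free; first exact: partns_uniq.
    by move=> nu; rewrite mem_partns => pnu; have /and3P[_ _ /eqP ->] := pnu.
  apply/funext => w; rewrite fct_sumE -[RHS]/(0 : rat).
  rewrite (eq_big_seq (fun nu => (size w == n)%:R * (partn_fact (content_type w))%:R *
      ((Kostka nu (content_type w))%:R * x nu))) => [|nu]; last first.
    rewrite mem_partns => pnu; rewrite -[LHS]/(x nu * _) (Schur_nc_coef w pnu).
    by case: eqP => _; rewrite ?mulr0 ?mul0r // mul1r natrM mulrC mulrA.
  rewrite -big_distrr /=; case: eqP => sw; last by rewrite !mul0r.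
  by rewrite key ?mulr0 // content_type_partn.
by rewrite mem_partns => /(_ pmu)/eqP; rewrite subr_eq0 => /eqP.
Qed.

Theorem theorem6p2 :
  (forall (n : nat) (la : seq nat), is_partn n la -> Pi_alg (Schur_nc la)) /\
  (* (i) *)
  (forall (n : nat) (la : seq nat), is_partn n la ->
     Schur_nc la =
       \sum_(mu \in [set mu : seq nat | is_partn n mu /\ dominated mu la])
         ((partn_fact mu)%:R * (Kostka la mu)%:R : rat) *:
           \sum_(P : {set {set 'I_n}} |
                  set_partition P && (block_type P == mu)) m_nc P) /\
  (* (ii) *)
  (forall (s : seq (seq nat)) (c : seq nat -> rat), uniq s ->
     (forall la, la \in s -> is_partn (sumn la) la) ->
     \sum_(la <- s) c la *: Schur_nc la = 0 ->
     forall la, la \in s -> c la = 0) /\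
  (* (iii) *)
  (forall (n : nat) (la : seq nat), is_partn n la ->
     rho (Schur_nc la) = (n`!%:R : rat) *: schur la) /\
  (* (iv) *)
  (forall R : cseries -> ncseries, is_lifting_map R ->
     forall (n : nat) (la : seq nat), is_partn n la ->
     R ((n`!%:R : rat) *: schur la) = Schur_nc la) /\
  (* (v) *)
  (forall B : ncseries -> ncseries -> rat, is_Pi_form B ->
     forall (n : nat) (la mu : seq nat), is_partn n la -> is_partn n mu ->
     B (Schur_nc la) (Schur_nc mu) = n`!%:R ^+ 2 * (la == mu)%:R).
Proof.
split; first exact: Schur_nc_Pi.
split.
  move=> n la pla; rewrite (Schur_nc_partns pla) (@fsbig_fwiden _ _ _ _ (partns n)).
  - by apply: eq_bigr => mu _; rewrite natrM.
  - by move=> mu [/= pmu _]; rewrite mem_partns.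
  - exact: partns_uniq.
  (* Partitions that [la] does not dominate have Kostka number 0, so the sum over all partitions of
     [n] reduces to the stated one. *)
  - move=> mu [/=]; rewrite mem_partns => pmu nd.
    case: (eqVneq (Kostka la mu) 0%N) => [->|K0]; first by rewrite mulr0 scale0r.
    by case: nd; split=> //; apply: Kostka_dominated pla K0.
split; first exact: Schur_nc_free.
split; first exact: rho_Schur_nc.
split; first by move=> R HR n la; apply: lifting_schur.
by move=> B HB n la mu; apply: Pi_form_Schur.
Qed.
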